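(* Let $n>1$ be an odd integer. Then for all $z\in\mathbb{C}\setminus\mathbb{R}_{\le 0}$, \[ \psi_{-n}(z) \ = \ \frac{(2\pi i)^{n}}{\zeta(n)(n+1)!}\sum_{m=0}^{n+1}{n+1 \choose m}B_{m} \, B_{n+1-m} \, z^{m-1} \] and \[ g_{-n}(z) \ = \ \frac{(2\pi i)^{n}}{i(n+1)!}\sum_{m=0}^{n}{n+1 \choose m+1} B_{m+1} \, B_{n-m} \, z^{m} . \]
   Context: For $a\in\mathbb{C}$ (with $\zeta(-a)\neq0$) and $\Im(z)>0$, let $E_{a+1}(z)=1+\frac{2}{\zeta(-a)}\sum_{n\ge1}\sigma_a(n)e^{2\pi i n z}$, where $\sigma_a(n)=\sum_{d\mid n}d^a$ and $\zeta$ is the Riemann zeta function, and let $\psi_a(z)=E_{a+1}(z)-z^{-a-1}E_{a+1}(-1/z)$ (principal branch of the power). It is known (Bettin--Conrey) that $\psi_a$ extends to an analytic function on $\mathbb{C}\setminus\mathbb{R}_{\le0}$; $\psi_a$ denotes this extension. The function $g_a$ on $\mathbb{C}\setminus\mathbb{R}_{\le0}$ is defined by the relation \[ \psi_{a}(z) = \frac{i}{\pi z}\frac{\zeta(1-a)}{\zeta(-a)}-\frac{i}{z^{1+a}}\cot\frac{\pi a}{2}+i\frac{g_{a}(z)}{\zeta(-a)}. \] $B_m$ denotes the $m$-th Bernoulli number, defined by $\frac{t}{e^t-1}=\sum_{m\ge0}B_m\frac{t^m}{m!}$ (the value of $B_1$ is irrelevant in these formulas since it is only multiplied by $B_n=0$).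 *)

(* Defs.v *)
(* Stdlib reals and Coquelicot complex numbers. *)
From Stdlib Require Import Reals ZArith Arith Lia Lra ClassicalEpsilon.
From Coquelicot Require Import Coquelicot.

Open Scope R_scope.
Open Scope C_scope.

Definition Cexp (z : C) : C := (exp (Re z) * cos (Im z), exp (Re z) * sin (Im z))%R.

Definition Csin (z : C) : C := (Cexp (Ci * z) - Cexp (- (Ci * z))) / (2 * Ci).

Definition Ccos (z : C) : C := (Cexp (Ci * z) + Cexp (- (Ci * z))) / 2.

Definition Ccot (z : C) : C := Ccos z / Csin z.

(* Principal argument, with values in (-PI, PI]; meaningful for z <> 0. *)
Definition Carg (z : C) : R :=
  if Rle_dec 0 (Im z) then acos (Re z / Cmod z) else (- acos (Re z / Cmod z))%R.

Definition Clog (z : C) : C := (ln (Cmod z), Carg z).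

(* Principal branch of z^s; meaningful for z <> 0. *)
Definition Cpower (z s : C) : C := Cexp (s * Clog z).

(* Integer power; meaningful for z <> 0 when k < 0. *)
Definition CpowerZ (z : C) (k : Z) : C :=
  if (0 <=? k)%Z then z ^ Z.to_nat k else / (z ^ Z.to_nat (- k)).

(* The sum of a convergent complex series; an unspecified value otherwise. *)
Definition CSeries (u : nat -> C) : C :=
  (Series (fun k => Re (u k)), Series (fun k => Im (u k))).

Definition analytic_at (f : C -> C) (z0 : C) : Prop :=
  exists (c : nat -> C) (r : R), (0 < r)%R /\
    forall z : C, (Cmod (z - z0) < r)%R ->
      @is_pseries C_AbsRing (AbsRing_NormedModule C_AbsRing) c (z - z0) (f z).

Definition analytic_on (D : C -> Prop) (f : C -> C) : Prop :=
  forall z : C, D z -> analytic_at f z.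

(* The complement of the half-line of nonpositive reals. *)
Definition slit_plane (z : C) : Prop := ~ (Im z = 0%R /\ (Re z <= 0)%R).

Definition upper_half_plane (z : C) : Prop := (0 < Im z)%R.

Definition dirichlet_zeta (s : C) : C :=
  CSeries (fun k => / Cpower (INR (S k)) s).

Definition is_zeta_continuation (f : C -> C) : Prop :=
  analytic_on (fun s => s <> 1) f /\
  forall s : C, (1 < Re s)%R -> f s = dirichlet_zeta s.

(* The Riemann zeta function on s <> 1 (the value at the pole s = 1 is
   unspecified): the Dirichlet series where it converges absolutely, and its
   unique analytic continuation elsewhere. *)
Definition zeta (s : C) : C :=
  if Rlt_dec 1 (Re s) then dirichlet_zeta s
  else epsilon (inhabits dirichlet_zeta) is_zeta_continuation s.

Definition divisor_sigma (a : C) (n : nat) : C :=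
  sum_n_m (fun d => if (n mod d =? 0)%nat then Cpower (INR d) a else RtoC 0) 1 n.

(* [E a] is the function usually written E_{a+1}: the index is shifted. *)
Definition E (a z : C) : C :=
  1 + 2 / zeta (- a) *
      CSeries (fun k => divisor_sigma a (S k) * Cexp (2 * PI * Ci * INR (S k) * z)).

Definition is_psi (a : C) (f : C -> C) : Prop :=
  analytic_on slit_plane f /\
  forall z : C, upper_half_plane z ->
    f z = E a z - Cpower z (- a - 1) * E a (- 1 / z).

(* The analytic extension of the period function to the slit plane; it is
   unique there, and its values on the cut are unspecified. *)
Definition psi (a : C) : C -> C := epsilon (inhabits (fun _ => RtoC 0)) (is_psi a).

(* The function defined by the relation of [psi_g], solved for [g a z]. *)
Definition g (a z : C) : C :=
  zeta (- a) / Ci *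
  (psi a z - Ci / (PI * z) * (zeta (1 - a) / zeta (- a))
   + Ci / Cpower z (1 + a) * Ccot (PI * a / 2)).

Lemma psi_g (a z : C) : zeta (- a) <> 0 ->
  psi a z = Ci / (PI * z) * (zeta (1 - a) / zeta (- a))
            - Ci / Cpower z (1 + a) * Ccot (PI * a / 2)
            + Ci * (g a z / zeta (- a)).
Proof.
intros hz; unfold g.
generalize (Ci / (PI * z) * (zeta (1 - a) / zeta (- a))).
generalize (Ci / Cpower z (1 + a) * Ccot (PI * a / 2)).
intros u v; field; split; [exact Ci_nz | exact hz].
Qed.

Definition is_bernoulli (B : nat -> R) : Prop :=
  exists r : R, (0 < r)%R /\
    forall t : R, t <> 0%R -> (Rabs t < r)%R ->
      is_pseries (fun m => (B m / INR (fact m))%R) t (t / (exp t - 1))%R.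

(* The Bernoulli numbers, with B_1 = -1/2. *)
Definition bernoulli : nat -> R := epsilon (inhabits (fun _ => 0%R)) is_bernoulli.

(* Main.v *)
(* With [n = 2 p + 1], the Lambert series of [E] gives
   [zeta(n) E(z) = sum_d d^(-n) coth(- pi i d z)]. The partial fractions of [coth] turn this
   into a double series over pairs [(d, k)]; in
   [zeta(n) (E(z) - z^(n-1) E(-1/z))] the two general terms combine into
   [- (2i/pi) z ((k^2)^p - ((d z)^2)^p) / ((k^2 - (d z)^2) (d k)^(2p))], a finite geometric sum, so the
   double series splits into products [zeta(2l+2) zeta(2p-2l)]. The same partial fractions on
   the real axis give both the convergence of the generating series of the Bernoulli numbers
   and their values in terms of [zeta(2j)]. Finally [psi] is determined by its values on the
   upper half-plane: every point of the slit plane is joined to that half-plane by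
   a segment, along which the identity theorem is a statement on real power series. *)
Require Import Defs.
From Stdlib Require Import Reals ZArith Arith Lra Lia ClassicalEpsilon.
From Coquelicot Require Import Coquelicot.

Open Scope R_scope.
Open Scope C_scope.

(** * Complex limits and sums *)

(** The delicate point is the exchange of [d] and [k] in the double series. It is carried out only
    in finite sums over the squares [d, k < N], which are symmetric, so that the reciprocity is an
    exact identity for every [N], with truncated zeta values; a single passage to the limit follows.
    That passage rests on a majorant [c / (d^2 k^2)]: the terms of the partial fractions at
    [- 2 pi i d z] are only of order [d / k^2], and the weight [d^(-n)] compensates for this as soon
    as [n >= 3]. The partial fractions themselves come from iterating the duplication formula of
    [coth], which yields finite sums of [2^M] cotangents whose limit is taken termwise. Both [psi]
    and [bernoulli] are choices made by [epsilon], so existence must be proved along with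
    uniqueness; in both cases the explicit formula is shown to satisfy the defining property. In
    particular the analytic extension of the period function is constructed, not assumed. *)

Definition Clim (u : nat -> C) (l : C) : Prop :=
  is_lim_seq (fun n => Re (u n)) (Re l) /\ is_lim_seq (fun n => Im (u n)) (Im l).

(** The upper bound is excluded, unlike in [sum_n], so that [sum_n f n] is [Csum f (S n)] and the
    empty sum exists. *)
Fixpoint Csum (f : nat -> C) (n : nat) : C :=
  match n with O => 0 | S m => Csum f m + f m end.

Lemma Clim_ext_loc (u v : nat -> C) (l : C) (N : nat) :
  (forall n, (N <= n)%nat -> u n = v n) -> Clim u l -> Clim v l.
Proof.
intros h [h1 h2]; split.
- apply is_lim_seq_ext_loc with (2 := h1); exists N; intros n hn; now rewrite h.
- apply is_lim_seq_ext_loc with (2 := h2); exists N; intros n hn; now rewrite h.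
Qed.

Lemma Clim_ext (u v : nat -> C) (l : C) :
  (forall n, u n = v n) -> Clim u l -> Clim v l.
Proof. intros h; apply (Clim_ext_loc u v l 0); intros; apply h. Qed.

Lemma Clim_const (c : C) : Clim (fun _ => c) c.
Proof. split; apply is_lim_seq_const. Qed.

Lemma Clim_RtoC (u : nat -> R) (l : R) : is_lim_seq u l -> Clim u l.
Proof. intros h; split; [exact h | apply is_lim_seq_const]. Qed.

Lemma Clim_plus (u v : nat -> C) (a b : C) :
  Clim u a -> Clim v b -> Clim (fun n => u n + v n) (a + b).
Proof. intros [h1 h2] [h3 h4]; split; simpl; now apply is_lim_seq_plus'. Qed.

Lemma Clim_minus (u v : nat -> C) (a b : C) :
  Clim u a -> Clim v b -> Clim (fun n => u n - v n) (a - b).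
Proof. intros [h1 h2] [h3 h4]; split; simpl; now apply is_lim_seq_minus'. Qed.

Lemma Clim_mult (u v : nat -> C) (a b : C) :
  Clim u a -> Clim v b -> Clim (fun n => u n * v n) (a * b).
Proof.
intros [h1 h2] [h3 h4]; split; simpl.
- apply is_lim_seq_minus'; now apply is_lim_seq_mult'.
- apply is_lim_seq_plus'; now apply is_lim_seq_mult'.
Qed.

Lemma Csqnorm_neq_0 (c : C) : c <> 0 -> (Re c * (Re c * 1) + Im c * (Im c * 1) <> 0)%R.
Proof.
intros hc h; apply hc; destruct c as [x y]; simpl in h.
apply injective_projections; simpl; nra.
Qed.

Lemma Clim_inv (u : nat -> C) (a : C) :
  a <> 0 -> Clim u a -> Clim (fun n => / u n) (/ a).
Proof.
intros ha [h1 h2]; pose proof (Csqnorm_neq_0 a ha) as hn.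
assert (is_lim_seq (fun n => Re (u n) * (Re (u n) * 1) + Im (u n) * (Im (u n) * 1))%R
  (Re a * (Re a * 1) + Im a * (Im a * 1))%R).
{ apply is_lim_seq_plus'; repeat apply is_lim_seq_mult';
    try apply is_lim_seq_const; assumption. }
split; simpl.
- now apply is_lim_seq_div'.
- apply is_lim_seq_div'; try assumption.
  now apply (is_lim_seq_opp (fun n => Im (u n)) (Im a)).
Qed.

Lemma Clim_div (u v : nat -> C) (a b : C) :
  b <> 0 -> Clim u a -> Clim v b -> Clim (fun n => u n / v n) (a / b).
Proof. intros hb hu hv; apply Clim_mult; [exact hu | now apply Clim_inv]. Qed.

Lemma Clim_unique (u : nat -> C) (a b : C) : Clim u a -> Clim u b -> a = b.
Proof.
intros [h1 h2] [h3 h4]; apply injective_projections.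
- apply is_lim_seq_unique in h1; apply is_lim_seq_unique in h3.
  rewrite h1 in h3; now injection h3.
- apply is_lim_seq_unique in h2; apply is_lim_seq_unique in h4.
  rewrite h2 in h4; now injection h4.
Qed.


Lemma Im_le_Cmod (c : C) : (Rabs (Im c) <= Cmod c)%R.
Proof.
eapply Rle_trans; [apply Rmax_r | apply (Rmax_Cmod c)].
Qed.

Lemma Clim_0_bound (u : nat -> C) (e : nat -> R) (N : nat) :
  (forall n, (N <= n)%nat -> (Cmod (u n) <= e n)%R) -> is_lim_seq e 0%R -> Clim u 0.
Proof.
intros h he.
assert (forall p : C -> R, (forall c, (Rabs (p c) <= Cmod c)%R) ->
  is_lim_seq (fun n => p (u n)) 0%R) as H.
{ intros p hp; apply is_lim_seq_abs_0.
  apply is_lim_seq_le_le_loc with (u := fun _ => 0%R) (w := e).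
  - exists N; intros n hn; split; [apply Rabs_pos |].
    eapply Rle_trans; [apply hp | now apply h].
  - apply is_lim_seq_const.
  - exact he. }
split; [apply (H Re), re_le_Cmod | apply (H Im), Im_le_Cmod].
Qed.

Lemma Clim_of_diff (u v : nat -> C) (l : C) :
  Clim (fun n => u n - v n) 0 -> Clim v l -> Clim u l.
Proof.
intros h1 h2; pose proof (Clim_plus _ _ _ _ h1 h2) as h.
replace (0 + l) with l in h by ring.
revert h; apply Clim_ext; intros n; ring.
Qed.

Lemma Clim_bound (u : nat -> C) (l : C) (e : nat -> R) (N : nat) :
  (forall n, (N <= n)%nat -> (Cmod (u n - l) <= e n)%R) -> is_lim_seq e 0%R -> Clim u l.
Proof.
intros h he; apply Clim_of_diff with (v := fun _ => l); [| apply Clim_const].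
now apply Clim_0_bound with e N.
Qed.

Lemma Clim_Cmod (u : nat -> C) (l : C) : Clim u l -> is_lim_seq (fun n => Cmod (u n)) (Cmod l).
Proof.
intros [h1 h2]; unfold Cmod.
apply is_lim_seq_continuous with
  (f := sqrt) (u := fun n => (fst (u n) ^ 2 + snd (u n) ^ 2)%R).
- apply continuity_pt_filterlim, continuous_sqrt.
- apply is_lim_seq_plus'; simpl; repeat apply is_lim_seq_mult';
    try apply is_lim_seq_const; assumption.
Qed.

Lemma Clim_Cmod_le (u : nat -> C) (l : C) (M : R) (N : nat) :
  Clim u l -> (forall n, (N <= n)%nat -> (Cmod (u n) <= M)%R) -> (Cmod l <= M)%R.
Proof.
intros h hb.
apply (is_lim_seq_le_loc (fun n => Cmod (u n)) (fun _ => M) (Cmod l) M).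
- exists N; intros n hn; now apply hb.
- now apply Clim_Cmod.
- apply is_lim_seq_const.
Qed.

Lemma Clim_incr (u : nat -> C) (l : C) : Clim u l <-> Clim (fun n => u (S n)) l.
Proof.
unfold Clim; rewrite (is_lim_seq_incr_1 (fun n => Re (u n))).
now rewrite (is_lim_seq_incr_1 (fun n => Im (u n))).
Qed.

Lemma Csum_S (f : nat -> C) (n : nat) : Csum f (S n) = Csum f n + f n.
Proof. reflexivity. Qed.

Lemma Csum_ext (f g : nat -> C) (n : nat) :
  (forall k, (k < n)%nat -> f k = g k) -> Csum f n = Csum g n.
Proof.
induction n as [|n IH]; intros h; simpl; [reflexivity |].
rewrite IH by (intros; apply h; lia); now rewrite h by lia.
Qed.

Lemma Csum_plus (f g : nat -> C) (n : nat) :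
  Csum (fun k => f k + g k) n = Csum f n + Csum g n.
Proof. induction n as [|n IH]; simpl; [ring | rewrite IH; ring]. Qed.

Lemma Csum_minus (f g : nat -> C) (n : nat) :
  Csum (fun k => f k - g k) n = Csum f n - Csum g n.
Proof. induction n as [|n IH]; simpl; [ring | rewrite IH; ring]. Qed.

Lemma Csum_scal (c : C) (f : nat -> C) (n : nat) :
  Csum (fun k => c * f k) n = c * Csum f n.
Proof. induction n as [|n IH]; simpl; [ring | rewrite IH; ring]. Qed.

Lemma Csum_zero (f : nat -> C) (n : nat) :
  (forall k, (k < n)%nat -> f k = 0) -> Csum f n = 0.
Proof.
induction n as [|n IH]; intros h; simpl; [reflexivity |].
rewrite IH by (intros; apply h; lia); rewrite h by lia; ring.
Qed.

Lemma Csum_first (f : nat -> C) (n : nat) :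
  Csum f (S n) = f O + Csum (fun k => f (S k)) n.
Proof. induction n as [|n IH]; [simpl; ring |]. simpl in *; rewrite IH; ring. Qed.

Lemma Csum_add (f : nat -> C) (n m : nat) :
  Csum f (n + m) = Csum f n + Csum (fun k => f (n + k)%nat) m.
Proof.
induction m as [|m IH]; [rewrite Nat.add_0_r; simpl; ring |].
rewrite Nat.add_succ_r; simpl; rewrite IH; ring.
Qed.

Lemma Csum_rev (f : nat -> C) (n : nat) :
  Csum f n = Csum (fun k => f (n - 1 - k)%nat) n.
Proof.
revert f; induction n as [|n IH]; intros f; [reflexivity |].
rewrite Csum_first, (IH (fun k => f (S k))).
change (Csum (fun k => f (S n - 1 - k)%nat) (S n)) with
  (Csum (fun k => f (S n - 1 - k)%nat) n + f (S n - 1 - n)%nat).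
replace (S n - 1 - n)%nat with O by lia.
rewrite (Csum_ext (fun k => f (S (n - 1 - k))) (fun k => f (S n - 1 - k)%nat)); [ring |].
intros k hk; f_equal; lia.
Qed.

Lemma Csum_exchange (f : nat -> nat -> C) (n m : nat) :
  Csum (fun i => Csum (fun j => f i j) m) n = Csum (fun j => Csum (fun i => f i j) n) m.
Proof.
induction n as [|n IH]; simpl.
- symmetry; now apply Csum_zero.
- now rewrite IH, Csum_plus.
Qed.

Lemma Csum_even (f : nat -> C) (q : nat) :
  (forall l, (l < q)%nat -> f (2 * l + 1)%nat = 0) ->
  Csum f (2 * q + 1) = Csum (fun l => f (2 * l)%nat) (q + 1).
Proof.
induction q as [|q IH]; intros h; [reflexivity |].
replace (2 * S q + 1)%nat with (S (S (2 * q + 1))) by lia.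
replace (S q + 1)%nat with (S (q + 1)) by lia.
rewrite !Csum_S, IH by (intros; apply h; lia).
rewrite h by lia; replace (S (2 * q + 1)) with (2 * (q + 1))%nat by lia; ring.
Qed.

Lemma Csum_sum_n (f : nat -> C) (n : nat) : sum_n f n = Csum f (S n).
Proof.
induction n as [|n IH].
- rewrite sum_O; simpl; symmetry; apply Cplus_0_l.
- rewrite sum_Sn, IH; reflexivity.
Qed.

Lemma Re_Csum (f : nat -> C) (n : nat) : Re (Csum f (S n)) = sum_n (fun k => Re (f k)) n.
Proof.
induction n as [|n IH]; [rewrite sum_O; apply Rplus_0_l |].
rewrite sum_Sn, <- IH; reflexivity.
Qed.

Lemma Im_Csum (f : nat -> C) (n : nat) : Im (Csum f (S n)) = sum_n (fun k => Im (f k)) n.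
Proof.
induction n as [|n IH]; [rewrite sum_O; apply Rplus_0_l |].
rewrite sum_Sn, <- IH; reflexivity.
Qed.

Lemma CSeries_unique (f : nat -> C) (l : C) : Clim (Csum f) l -> CSeries f = l.
Proof.
intros h; apply Clim_incr in h; destruct h as [h1 h2]; apply injective_projections; simpl.
- apply is_series_unique.
  change (is_lim_seq (sum_n (fun k => Re (f k))) (Re l)).
  revert h1; apply is_lim_seq_ext; intros n; apply Re_Csum.
- apply is_series_unique.
  change (is_lim_seq (sum_n (fun k => Im (f k))) (Im l)).
  revert h2; apply is_lim_seq_ext; intros n; apply Im_Csum.
Qed.

(** * Majorants of order 1 / k^2 and exchange of limits *)

Lemma is_lim_seq_div_n (c : R) : is_lim_seq (fun n => c / INR n)%R 0%R.
Proof.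
replace 0%R with (c * 0)%R by ring.
apply (is_lim_seq_scal_l (fun n => / INR n)%R c 0%R).
apply (is_lim_seq_inv INR p_infty); [apply is_lim_seq_INR | discriminate].
Qed.

(** Telescoping, by [1 / (x + 1)^2 <= 1 / (x (x + 1)) = 1 / x - 1 / (x + 1)]. A majorant [c / k^2]
    thus has an explicit tail. *)
Lemma Csum_tail (f : nat -> C) (c : R) (K d : nat) :
  (1 <= K)%nat -> (0 <= c)%R ->
  (forall k, (K <= k < K + d)%nat -> (Cmod (f k) <= c / INR (S k) ^ 2)%R) ->
  (Cmod (Csum f (K + d) - Csum f K) <= c / INR K - c / INR (K + d))%R.
Proof.
intros hK hc; induction d as [|d IH]; intros h.
- rewrite Nat.add_0_r; replace (Csum f K - Csum f K) with (RtoC 0) by ring.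
  rewrite Cmod_0; lra.
- rewrite Nat.add_succ_r; rewrite Csum_S.
  replace (Csum f (K + d) + f (K + d)%nat - Csum f K) with
    (Csum f (K + d) - Csum f K + f (K + d)%nat) by ring.
  eapply Rle_trans; [apply Cmod_triangle |].
  assert (h1 := IH ltac:(intros; apply h; lia)).
  assert (h2 := h (K + d)%nat ltac:(lia)).
  assert (c / INR (S (K + d)) ^ 2 <= c / INR (K + d) - c / INR (S (K + d)))%R; [| lra].
  assert (0 < INR (K + d))%R by (apply lt_0_INR; lia).
  rewrite S_INR; set (x := INR (K + d)) in *.
  replace (c / x - c / (x + 1))%R with (c * / (x * (x + 1)))%R by (field; lra).
  unfold Rdiv; apply Rmult_le_compat_l; [exact hc |].
  apply Rinv_le_contravar; nra.
Qed.

Lemma Csum_tail_le (f : nat -> C) (c : R) (K m : nat) :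
  (1 <= K <= m)%nat -> (0 <= c)%R ->
  (forall k, (K <= k < m)%nat -> (Cmod (f k) <= c / INR (S k) ^ 2)%R) ->
  (Cmod (Csum f m - Csum f K) <= c / INR K)%R.
Proof.
intros hK hc h.
replace m with (K + (m - K))%nat by lia.
eapply Rle_trans; [apply Csum_tail with (c := c); try lia; try assumption |].
- intros; apply h; lia.
- assert (0 <= c / INR (K + (m - K)))%R; [| lra].
  apply Rdiv_le_0_compat; [exact hc | apply lt_0_INR; lia].
Qed.

(** The first term and the tail after it contribute at most [c] each. *)
Lemma Csum_bound (f : nat -> C) (c : R) (m : nat) :
  (0 <= c)%R ->
  (forall k, (k < m)%nat -> (Cmod (f k) <= c / INR (S k) ^ 2)%R) ->
  (Cmod (Csum f m) <= 2 * c)%R.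
Proof.
intros hc h; destruct m as [|m]; [simpl; rewrite Cmod_0; lra |].
replace (Csum f (S m)) with (f O + (Csum f (S m) - Csum f 1)) by (simpl; ring).
eapply Rle_trans; [apply Cmod_triangle |].
assert (h0 := h O ltac:(lia)); simpl in h0.
replace (c / (1 * (1 * 1)))%R with c in h0 by field.
assert (h1 := Csum_tail_le f c 1 (S m) ltac:(lia) hc ltac:(intros; apply h; lia)).
simpl (INR 1) in h1; lra.
Qed.

Lemma Clim_Csum_tail (f : nat -> C) (c : R) (l : C) (K : nat) :
  (1 <= K)%nat -> (0 <= c)%R ->
  (forall k, (K <= k)%nat -> (Cmod (f k) <= c / INR (S k) ^ 2)%R) ->
  Clim (Csum f) l -> (Cmod (l - Csum f K) <= c / INR K)%R.
Proof.
intros hK hc h hl.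
apply Clim_Cmod_le with (u := fun m => Csum f m - Csum f K) (N := K).
- apply Clim_minus; [exact hl | apply Clim_const].
- intros m hm; apply Csum_tail_le; try lia; try assumption; intros; apply h; lia.
Qed.

(** The partial sums of the majorant increase and stay below [2 * c]; comparison then applies to
    real and imaginary parts separately. *)
Lemma Csum_converges (f : nat -> C) (c : R) :
  (0 <= c)%R -> (forall k, (Cmod (f k) <= c / INR (S k) ^ 2)%R) ->
  exists l, Clim (Csum f) l.
Proof.
intros hc h.
assert (ex_series (fun k => c / INR (S k) ^ 2)%R) as hs.
{ apply (ex_finite_lim_seq_incr _ (2 * c)%R).
  - intros n; rewrite sum_Sn; unfold plus; simpl.
    assert (0 <= c / (INR (S (S n)) * (INR (S (S n)) * 1)))%R; [| simpl in *; lra].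
    apply Rdiv_le_0_compat; [exact hc |].
    assert (0 < INR (S (S n)))%R by (apply lt_0_INR; lia); nra.
  - intros n.
    rewrite (sum_n_ext _ (fun k => Re (RtoC (c / INR (S k) ^ 2)%R))) by reflexivity.
    rewrite <- Re_Csum.
    eapply Rle_trans; [apply Rle_abs |].
    eapply Rle_trans; [apply re_le_Cmod |].
    apply Csum_bound; [exact hc |].
    intros k _; rewrite Cmod_R, Rabs_pos_eq; [lra |].
    apply Rdiv_le_0_compat; [exact hc |].
    assert (0 < INR (S k))%R by (apply lt_0_INR; lia); nra. }
assert (forall p : C -> R, (forall z, (Rabs (p z) <= Cmod z)%R) -> ex_series (fun k => p (f k))) as H.
{ intros p hp; apply (ex_series_le (K := R_AbsRing) (V := R_CompleteNormedModule)) with (2 := hs).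
  intros k; eapply Rle_trans; [apply hp | apply h]. }
destruct (H Re re_le_Cmod) as [l1 h1]; destruct (H Im Im_le_Cmod) as [l2 h2].
exists (l1, l2); apply Clim_incr; split; simpl.
- apply is_lim_seq_ext with (2 := h1); intros n; symmetry; apply Re_Csum.
- apply is_lim_seq_ext with (2 := h2); intros n; symmetry; apply Im_Csum.
Qed.

(* Tannery's theorem. *)
Lemma Csum_dominated (f : nat -> nat -> C) (l : nat -> C) (A : nat -> C) (a : C)
    (m : nat -> nat) (c : R) (K0 N0 : nat) :
  (0 <= c)%R ->
  (forall K, exists N, forall n, (N <= n)%nat -> (K <= m n)%nat) ->
  (forall n k, (N0 <= n)%nat -> (K0 <= k < m n)%nat -> (Cmod (f n k) <= c / INR (S k) ^ 2)%R) ->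
  (forall k, Clim (fun n => f n k) (l k)) ->
  (forall n, A n = Csum (f n) (m n)) -> Clim A a ->
  Clim (Csum l) a.
Proof.
intros hc hm hf hl hA ha.
apply Clim_bound with (e := fun n => (c / INR n)%R) (N := S K0); [| apply is_lim_seq_div_n].
intros K hK; destruct (hm K) as [N hN].
replace (Csum l K - a) with (- (a - Csum l K)) by ring; rewrite Cmod_opp.
(* The tail is bounded before the limit in [n]: [A n] minus its first [K] terms is at most [c / K]
   for all large [n], and it converges to [a - Csum l K]. *)
apply Clim_Cmod_le with (u := fun n => A n - Csum (f n) K) (N := (N + N0)%nat).
- apply Clim_minus; [exact ha |].
  clear hK hN; induction K as [|K IH]; simpl; [apply Clim_const |].
  apply Clim_plus; [exact IH | apply hl].
- intros n hn; rewrite hA; apply Csum_tail_le; [| exact hc |].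
  + split; [lia | apply hN; lia].
  + intros k hk; apply hf; lia.
Qed.

(** Truncating row [d] at [N] costs at most [c / (d^2 N)], hence [2 c / N] over all rows. Iterated
    sums can therefore be replaced by sums over squares, which are symmetric in the two indices. *)
Lemma Clim_square_sum (a : nat -> nat -> C) (A : nat -> C) (c : R) :
  (0 <= c)%R ->
  (forall d k, (Cmod (a d k) <= c / INR (S d) ^ 2 / INR (S k) ^ 2)%R) ->
  (forall d, Clim (Csum (a d)) (A d)) ->
  Clim (fun N => Csum A N - Csum (fun d => Csum (a d) N) N) 0.
Proof.
intros hc ha hA.
apply Clim_0_bound with (e := fun n => (2 * c / INR n)%R) (N := 1%nat);
  [| apply is_lim_seq_div_n].
intros N hN; rewrite <- Csum_minus.
assert (0 < INR N)%R by (apply lt_0_INR; lia).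
replace (2 * c / INR N)%R with (2 * (c / INR N))%R by (field; lra).
assert (forall d, 0 <= c / INR (S d) ^ 2)%R.
{ intros d; apply Rdiv_le_0_compat; [exact hc |].
  apply pow_lt, lt_0_INR; lia. }
apply Csum_bound.
- apply Rdiv_le_0_compat; lra.
- intros d _.
  replace (c / INR N / INR (S d) ^ 2)%R with (c / INR (S d) ^ 2 / INR N)%R
    by (field; split; apply not_0_INR; lia).
  apply Clim_Csum_tail; auto.
Qed.

(** * Partial fractions of the hyperbolic cotangent *)

Lemma Cexp_plus (x y : C) : Cexp (x + y) = Cexp x * Cexp y.
Proof.
destruct x as [a b]; destruct y as [c d].
unfold Cexp; apply injective_projections; simpl;
  rewrite exp_plus, ?cos_plus, ?sin_plus; ring.
Qed.

Lemma Cexp_RtoC (x : R) : Cexp x = RtoC (exp x).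
Proof.
unfold Cexp, RtoC; simpl; rewrite cos_0, sin_0.
apply injective_projections; simpl; ring.
Qed.

Lemma Cexp_0 : Cexp 0 = 1.
Proof. rewrite Cexp_RtoC, exp_0; reflexivity. Qed.

Lemma Cexp_Ci (x : R) : Cexp (Ci * x) = (cos x, sin x).
Proof.
unfold Cexp; simpl.
replace (0 * x - 1 * 0)%R with 0%R by ring; replace (0 * 0 + 1 * x)%R with x by ring.
rewrite exp_0; apply injective_projections; simpl; ring.
Qed.

Lemma Cexp_PI : Cexp (Ci * PI) = - (1).
Proof.
rewrite Cexp_Ci, cos_PI, sin_PI; apply injective_projections; simpl; ring.
Qed.

Lemma Cexp_opp_r (x : C) : Cexp x * Cexp (- x) = 1.
Proof. rewrite <- Cexp_plus; replace (x + - x) with (RtoC 0) by ring; apply Cexp_0. Qed.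

Lemma Cmod_Cexp (x : C) : Cmod (Cexp x) = exp (Re x).
Proof.
unfold Cexp, Cmod; simpl.
replace (exp (Re x) * cos (Im x) * (exp (Re x) * cos (Im x) * 1) +
  exp (Re x) * sin (Im x) * (exp (Re x) * sin (Im x) * 1))%R
  with (exp (Re x) * exp (Re x) * (Rsqr (sin (Im x)) + Rsqr (cos (Im x))))%R
  by (unfold Rsqr; ring).
rewrite sin2_cos2, Rmult_1_r; apply sqrt_square, Rlt_le, exp_pos.
Qed.

Lemma Cexp_neq_0 (x : C) : Cexp x <> 0.
Proof. apply Cmod_gt_0; rewrite Cmod_Cexp; apply exp_pos. Qed.

Lemma Cexp_neq_1 (x : C) : Re x <> 0%R -> Cexp x - 1 <> 0.
Proof.
intros hx h; apply hx, exp_inv.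
rewrite exp_0, <- Cmod_Cexp, <- Cmod_1; f_equal.
now apply Ceq_minus.
Qed.

Lemma Cexp_neq_m1 (x : C) : Re x <> 0%R -> Cexp x + 1 <> 0.
Proof.
intros hx h; apply hx, exp_inv.
rewrite exp_0, <- Cmod_Cexp, <- Cmod_m1; f_equal.
replace (Cexp x) with (Cexp x + 1 - 1) by ring; rewrite h; ring.
Qed.

(* [Ccoth x] is the hyperbolic cotangent of [x / 2]. *)
Definition Ccoth (x : C) : C := (Cexp x + 1) / (Cexp x - 1).

Lemma Ccoth_PI (x : C) : Re x <> 0%R -> Ccoth (x + Ci * PI) = (Cexp x - 1) / (Cexp x + 1).
Proof.
intros hx; unfold Ccoth; rewrite Cexp_plus, Cexp_PI.
pose proof (Cexp_neq_m1 x hx).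
replace (Cexp x * - (1) + 1) with (- (Cexp x - 1)) by ring.
replace (Cexp x * - (1) - 1) with (- (Cexp x + 1)) by ring.
field; exact H.
Qed.

Lemma Ccoth_period (x : C) : Ccoth (x + 2 * (Ci * PI)) = Ccoth x.
Proof.
unfold Ccoth.
replace (x + 2 * (Ci * PI)) with (x + Ci * PI + Ci * PI) by ring.
rewrite !Cexp_plus, Cexp_PI; f_equal; [| f_equal]; ring.
Qed.

(** This is [2 coth x = coth (x/2) + tanh (x/2)], since [tanh] is [coth] shifted by half a
    period. *)
Lemma Ccoth_double (x : C) : Re x <> 0%R -> 2 * Ccoth (2 * x) = Ccoth x + Ccoth (x + Ci * PI).
Proof.
intros hx; rewrite Ccoth_PI by exact hx; unfold Ccoth.
replace (2 * x) with (x + x) by ring; rewrite Cexp_plus.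
pose proof (Cexp_neq_m1 x hx); pose proof (Cexp_neq_1 x hx).
field; repeat split; try assumption.
replace (Cexp x * Cexp x - 1) with ((Cexp x - 1) * (Cexp x + 1)) by ring.
now apply Cmult_neq_0.
Qed.

Lemma pow2_pos (M : nat) : (0 < 2 ^ M)%R.
Proof. apply pow_lt; lra. Qed.

Lemma RtoC_neq_0 (x : R) : x <> 0%R -> RtoC x <> 0.
Proof. intros h e; apply h; now apply RtoC_inj. Qed.

Lemma Re_div_R (x : C) (r : R) : r <> 0%R -> Re (x / r) = (Re x / r)%R.
Proof.
intros hr; unfold Cdiv; rewrite <- RtoC_inv by exact hr.
rewrite re_scal_r; reflexivity.
Qed.

Lemma Re_plus_Ci (x : C) (y : R) : Re (x + Ci * y) = Re x.
Proof. destruct x; simpl; ring. Qed.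

(** Duplication turns the shift [k] at level [M] into the shifts [k] and [2^M + k] at level
    [M + 1]. *)
Lemma Ccoth_dyadic (M : nat) (x : C) : Re x <> 0%R ->
  (2 ^ M)%R * Ccoth x =
  Csum (fun k => Ccoth ((x + Ci * (2 * PI * INR k)%R) / (2 ^ M)%R)) (2 ^ M).
Proof.
intros hx; induction M as [|M IH].
- change (2 ^ 0)%nat with 1%nat; change (2 ^ 0)%R with 1%R; rewrite Csum_S.
  change (INR 0) with 0%R; rewrite Rmult_0_r.
  replace ((x + Ci * 0) / 1) with x by field; simpl (Csum _ 0); ring.
- replace (2 ^ S M)%nat with (2 ^ M + 2 ^ M)%nat by (simpl; lia).
  rewrite Csum_add, <- Csum_plus.
  simpl (2 ^ S M)%R; rewrite RtoC_mult, <- Cmult_assoc, IH, <- Csum_scal.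
  apply Csum_ext; intros k _.
  pose proof (pow2_pos M) as hp.
  assert (RtoC (2 ^ M)%R <> 0) by (apply RtoC_neq_0; lra).
  replace ((x + Ci * (2 * PI * INR k)%R) / (2 ^ M)%R) with
    (2 * ((x + Ci * (2 * PI * INR k)%R) / (2 * (2 ^ M)%R))) by (field; assumption).
  rewrite Ccoth_double.
  + f_equal; f_equal.
    rewrite plus_INR, pow_INR, !RtoC_mult, RtoC_plus; simpl (INR 2).
    replace (1 + 1)%R with 2%R by ring; field; assumption.
  + rewrite <- RtoC_mult, Re_div_R, Re_plus_Ci by lra.
    intros h; apply hx.
    replace (Re x) with (Re x / (2 * 2 ^ M) * (2 * 2 ^ M))%R by (field; lra).
    rewrite h; ring.
Qed.

(** By periodicity the shift [2^(M+1) - k] is the shift [- k]. The pairs [k = 1, ..., 2^M] count the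
    middle shift [2^M], that is [Ci * PI], twice; the subtracted cotangent corrects this. *)
Lemma Ccoth_dyadic_sym (M : nat) (x : C) : Re x <> 0%R ->
  (2 ^ S M)%R * Ccoth x =
  Ccoth (x / (2 ^ S M)%R) - Ccoth (x / (2 ^ S M)%R + Ci * PI) +
  Csum (fun k => Ccoth (x / (2 ^ S M)%R + Ci * (2 * PI * INR (S k) / 2 ^ S M)%R) +
                 Ccoth (x / (2 ^ S M)%R - Ci * (2 * PI * INR (S k) / 2 ^ S M)%R)) (2 ^ M).
Proof.
intros hx; rewrite Ccoth_dyadic by exact hx.
pose proof (pow2_pos (S M)) as hp.
assert (RtoC (2 ^ S M)%R <> 0) as hr by (apply RtoC_neq_0; lra).
assert (INR (2 ^ M) = 2 ^ S M / 2)%R as hM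
  by (rewrite pow_INR; simpl (INR 2); replace (1 + 1)%R with 2%R by ring; simpl; field).
replace (2 ^ S M)%nat with (2 ^ M + 2 ^ M)%nat by (simpl; lia).
set (r := (2 ^ S M)%R) in *; set (q := (2 ^ M)%nat) in *.
rewrite Csum_add, (Csum_rev (fun k => Ccoth ((x + Ci * (2 * PI * INR (q + k))%R) / r))).
rewrite Csum_plus.
pose proof (Csum_first (fun k => Ccoth ((x + Ci * (2 * PI * INR k)%R) / r)) q) as e.
rewrite Csum_S in e.
rewrite (Csum_ext (fun k => Ccoth (x / r + Ci * (2 * PI * INR (S k) / r)%R))
  (fun k => Ccoth ((x + Ci * (2 * PI * INR (S k))%R) / r))).
2: { intros k _; f_equal; rewrite (RtoC_div _ r) by lra; field; exact hr. }
rewrite (Csum_ext (fun k => Ccoth (x / r - Ci * (2 * PI * INR (S k) / r)%R))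
  (fun k => Ccoth ((x + Ci * (2 * PI * INR (q + (q - 1 - k)))%R) / r))).
2: { intros k hk; rewrite <- Ccoth_period; f_equal.
  replace (q + (q - 1 - k))%nat with (q + q - S k)%nat by lia.
  rewrite minus_INR, plus_INR, hM by lia.
  replace (2 * PI * (r / 2 + r / 2 - INR (S k)))%R with
    (2 * PI * r - 2 * PI * INR (S k))%R by field.
  rewrite (RtoC_div _ r), RtoC_minus, (RtoC_mult _ r), (RtoC_mult 2 PI) by lra; field; exact hr. }
replace (x / r + Ci * PI) with ((x + Ci * (2 * PI * INR q)%R) / r).
2: { rewrite hM; replace (2 * PI * (r / 2))%R with (PI * r)%R by field.
  rewrite RtoC_mult; field; exact hr. }
replace (x / r) with ((x + Ci * (2 * PI * INR 0)%R) / r).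
2: { simpl (INR 0); rewrite Rmult_0_r; f_equal; ring. }
match goal with |- _ + ?s = _ => generalize s end; intros s.
match goal with |- ?a + s = ?b - ?c + (?d + s) =>
  replace a with (b + d - c); [ring | rewrite <- e; ring] end.
Qed.

(** Both sides equal [u^2 - 2 u cos b + 1] with [u = Cexp x]. Isolating [(u - 1)^2] prepares the
    scaling: at [x / r] and [b = 2 PI k / r], this quantity times [r^2] tends to
    [x^2 + 4 PI^2 k^2]. *)
Lemma Ccoth_pair_factor (x : C) (b : R) :
  (Cexp x - 1) ^ 2 + 4 * Cexp x * (sin (b / 2) * sin (b / 2))%R =
  (Cexp (x + Ci * b) - 1) * (Cexp (x - Ci * b) - 1).
Proof.
change (x - Ci * b) with (x + - (Ci * b)); rewrite !Cexp_plus.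
assert (Cexp (Ci * b) * Cexp (- (Ci * b)) = 1) as e1 by apply Cexp_opp_r.
assert (Cexp (Ci * b) + Cexp (- (Ci * b)) = 2 - 4 * (sin (b / 2) * sin (b / 2))%R) as e2.
{ replace (- (Ci * b)) with (Ci * (- b)%R) by (rewrite RtoC_opp; ring).
  rewrite !Cexp_Ci, cos_neg, sin_neg.
  replace b with (2 * (b / 2))%R at 1 3 by field; rewrite cos_2a_sin.
  apply injective_projections; simpl; ring. }
transitivity (Cexp x * Cexp x * (Cexp (Ci * b) * Cexp (- (Ci * b))) -
  Cexp x * (Cexp (Ci * b) + Cexp (- (Ci * b))) + 1); [rewrite e1, e2; ring | ring].
Qed.

Lemma Ccoth_pair_neq_0 (x : C) (b : R) : Re x <> 0%R ->
  Cexp (x + Ci * b) - 1 <> 0 /\ Cexp (x - Ci * b) - 1 <> 0.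
Proof.
intros hx; split; apply Cexp_neq_1; [now rewrite Re_plus_Ci |].
replace (x - Ci * b) with (x + Ci * (- b)%R) by (rewrite RtoC_opp; ring).
now rewrite Re_plus_Ci.
Qed.

Lemma Ccoth_pair (x : C) (b : R) : Re x <> 0%R ->
  Ccoth (x + Ci * b) + Ccoth (x - Ci * b) =
  2 * (Cexp x + 1) * (Cexp x - 1) /
    ((Cexp x - 1) ^ 2 + 4 * Cexp x * (sin (b / 2) * sin (b / 2))%R).
Proof.
intros hx; rewrite Ccoth_pair_factor.
destruct (Ccoth_pair_neq_0 x b hx) as [h1 h2]; unfold Ccoth.
change (x - Ci * b) with (x + - (Ci * b)) in *; rewrite !Cexp_plus in *.
assert (Cexp (Ci * b) * Cexp (- (Ci * b)) = 1) as e1 by apply Cexp_opp_r.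
set (u := Cexp x) in *; set (v := Cexp (Ci * b)) in *; set (v' := Cexp (- (Ci * b))) in *.
replace (2 * (u + 1) * (u - 1)) with (2 * u * u * (v * v') - 2) by (rewrite e1; ring).
field; split; assumption.
Qed.

Lemma is_lim_seq_inv_pow2 : is_lim_seq (fun n => / 2 ^ n)%R 0%R.
Proof.
apply (is_lim_seq_ext (fun n => (/ 2) ^ n)%R).
- intros n; apply pow_inv.
- apply is_lim_seq_geom; rewrite Rabs_pos_eq; lra.
Qed.

Lemma is_lim_seq_pow2_derive (f : R -> R) (l : R) :
  is_derive f 0 l -> is_lim_seq (fun n => 2 ^ n * (f (/ 2 ^ n) - f 0))%R l.
Proof.
intros h; apply is_derive_Reals in h.
apply is_lim_seq_spec; intros eps.
destruct (h eps (cond_pos eps)) as [d hd].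
pose proof is_lim_seq_inv_pow2 as h2; apply is_lim_seq_spec in h2.
destruct (h2 d) as [N hN]; exists N; intros n hn.
pose proof (pow2_pos n) as hp.
specialize (hN n hn); rewrite Rminus_0_r in hN.
specialize (hd (/ 2 ^ n)%R (Rinv_neq_0_compat _ (Rgt_not_eq _ _ hp)) hN).
rewrite Rplus_0_l in hd; unfold Rdiv in hd; rewrite Rinv_inv in hd.
now rewrite Rmult_comm.
Qed.

Lemma Clim_Cexp_sub_1 (x : C) :
  Clim (fun n => (2 ^ n)%R * (Cexp (x / (2 ^ n)%R) - 1)) x.
Proof.
destruct x as [a b].
assert (forall n, Cexp ((a, b) / (2 ^ n)%R) =
  (exp (a * / 2 ^ n) * cos (b * / 2 ^ n), exp (a * / 2 ^ n) * sin (b * / 2 ^ n))%R) as e.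
{ intros n; pose proof (pow2_pos n).
  replace ((a, b) / (2 ^ n)%R) with ((a * / 2 ^ n, b * / 2 ^ n)%R : C); [reflexivity |].
  unfold Cdiv; rewrite <- RtoC_inv by lra; apply injective_projections; simpl; ring. }
split.
- eapply is_lim_seq_ext;
    [| apply (is_lim_seq_pow2_derive (fun h => exp (a * h) * cos (b * h))%R a)].
  + intros n; rewrite e; simpl; rewrite !Rmult_0_r, exp_0, cos_0; ring.
  + auto_derive; [exact I |]; rewrite !Rmult_0_r, exp_0, cos_0, sin_0; ring.
- eapply is_lim_seq_ext;
    [| apply (is_lim_seq_pow2_derive (fun h => exp (a * h) * sin (b * h))%R b)].
  + intros n; rewrite e; simpl; rewrite !Rmult_0_r, exp_0, sin_0; ring.
  + auto_derive; [exact I |]; rewrite !Rmult_0_r, exp_0, cos_0, sin_0; ring.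
Qed.

Lemma is_lim_seq_pow2_sin (c : R) : is_lim_seq (fun n => 2 ^ n * sin (c / 2 ^ n))%R c.
Proof.
eapply is_lim_seq_ext; [| apply (is_lim_seq_pow2_derive (fun h => sin (c * h))%R c)].
- intros n; simpl; rewrite Rmult_0_r, sin_0, Rminus_0_r; reflexivity.
- auto_derive; [exact I |]; rewrite Rmult_0_r, cos_0; ring.
Qed.

(** The constant is [1 - 4/6]: in [y - y^3/6 + y^5/120 - y^7/5040] one uses [y^2 <= 4], and the last
    two terms have a nonnegative sum. Since [3 < PI], it yields [sin (PI s) >= s] for
    [0 <= s <= 1/2]. *)
Lemma sin_ge_third (y : R) : (0 <= y <= PI / 2 -> y / 3 <= sin y)%R.
Proof.
intros hy; pose proof PI_4.
destruct (SIN y) as [h _]; try lra.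
eapply Rle_trans; [| exact h].
unfold sin_lb, sin_approx, sum_f_R0, sin_term.
change (2 * 0 + 1)%nat with 1%nat; change (2 * 1 + 1)%nat with 3%nat.
change (2 * 2 + 1)%nat with 5%nat; change (2 * 3 + 1)%nat with 7%nat.
replace (INR (fact 1)) with 1%R by reflexivity.
replace (INR (fact 3)) with 6%R by (simpl; ring).
replace (INR (fact 5)) with 120%R by (simpl; ring).
replace (INR (fact 7)) with 5040%R by (simpl; ring).
assert (y * y <= 4)%R by nra.
assert (y * (y * y) <= y * 4)%R by (apply Rmult_le_compat_l; lra).
assert (0 <= y * (y * y) * (y * y))%R by (repeat apply Rmult_le_pos; lra).
assert (y * (y * y) * (y * y) * (y * y) <= y * (y * y) * (y * y) * 4)%R
  by (apply Rmult_le_compat_l; lra).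
simpl; lra.
Qed.

Lemma Cmod_triangle_sub (a b : C) : (Cmod a - Cmod b <= Cmod (a - b))%R.
Proof.
replace a with (a - b + b) at 1 by ring.
pose proof (Cmod_triangle (a - b) b); lra.
Qed.

Lemma Cmult_cancel_l (c a b : C) : c <> 0 -> c * a = c * b -> a = b.
Proof.
intros hc h; replace a with (/ c * (c * a)) by (field; exact hc).
rewrite h; field; exact hc.
Qed.

(** The sum of the two polar terms of [coth (x / 2)] at [2 pi i (k + 1)] and at its opposite. *)
Definition Ccoth_term (x : C) (k : nat) : C :=
  4 * x / (x * x + 4 * (PI * PI * (INR (S k) * INR (S k)))%R).

Lemma Ccoth_term_den (x : C) (k : nat) : Re x <> 0%R ->
  x * x + 4 * (PI * PI * (INR (S k) * INR (S k)))%R <> 0.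
Proof.
intros hx.
assert (forall y : R, x + Ci * y <> 0) as h.
{ intros y e; apply hx; rewrite <- (Re_plus_Ci x y), e; reflexivity. }
replace (x * x + 4 * (PI * PI * (INR (S k) * INR (S k)))%R) with
  ((x + Ci * (2 * PI * INR (S k))%R) * (x + Ci * (- (2 * PI * INR (S k)))%R)).
- apply Cmult_neq_0; apply h.
- apply injective_projections; simpl; ring.
Qed.

(** Tannery's theorem for the symmetric dyadic sum divided by [2^(n+1)]: the unpaired cotangent at
    shift 0 tends to [2 / x], the one at shift [Ci * PI] tends to 0, and each pair tends to a term
    of the series. *)
Lemma Ccoth_partial_fractions (x : C) : Re x <> 0%R ->
  Clim (Csum (Ccoth_term x)) (Ccoth x - 2 / x).
Proof.
intros hx.
assert (x <> 0) as hx0 by (intros e; apply hx; rewrite e; reflexivity).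
set (r := fun n : nat => (2 ^ S n)%R).
set (u := fun n => Cexp (x / r n)).
set (p := fun n => r n * (u n - 1)).
set (w := fun n k => (r n * sin (PI * INR (S k) / r n))%R).
assert (forall n, (0 < r n)%R) as hr by (intros n; apply pow2_pos).
assert (forall n, RtoC (r n) <> 0) as hrC
  by (intros n; apply RtoC_neq_0; specialize (hr n); lra).
assert (forall n, Re (x / r n) <> 0%R) as hxr.
{ intros n; rewrite Re_div_R by (specialize (hr n); lra).
  apply Rmult_integral_contrapositive; split; [exact hx |].
  apply Rinv_neq_0_compat; specialize (hr n); lra. }
assert (Clim p x) as hp by exact (proj1 (Clim_incr _ x) (Clim_Cexp_sub_1 x)).
assert (Clim (fun n => RtoC (/ r n)) 0) as hri
  by exact (Clim_RtoC _ _ (proj1 (is_lim_seq_incr_1 _ _) is_lim_seq_inv_pow2)).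
assert (Clim u 1) as hu.
{ replace (RtoC 1) with (1 + x * 0) by ring.
  apply Clim_ext with (fun n => 1 + p n * RtoC (/ r n)).
  - intros n; unfold p; rewrite RtoC_inv by (specialize (hr n); lra); field; apply hrC.
  - apply Clim_plus; [apply Clim_const | now apply Clim_mult]. }
assert (forall k, Clim (fun n => RtoC (w n k)) (PI * INR (S k))%R) as hw.
{ intros k; apply Clim_RtoC.
  exact (proj1 (is_lim_seq_incr_1 _ _) (is_lim_seq_pow2_sin (PI * INR (S k)))). }
(* The [k]-th pair divided by [r n], with [r n ^ 2] distributed over the denominator so that every
   factor has a limit: 1 for [u n], [x] for [p n], [PI * INR (S k)] for [w n k]. *)
set (f := fun n k => 2 * (u n + 1) * p n / (p n * p n + 4 * u n * (w n k * w n k))).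
set (P := (Cmod x + 1)%R).
assert (0 < P)%R as hP by (pose proof (Cmod_ge_0 x); unfold P; lra).
assert (exists N, forall n, (N <= n)%nat -> (Cmod (p n) <= P)%R) as [N1 hN1].
{ pose proof (Clim_Cmod _ _ hp) as h; apply is_lim_seq_spec in h.
  destruct (h (mkposreal 1 Rlt_0_1)) as [N hN]; exists N; intros n hn.
  specialize (hN n hn); simpl in hN; apply Rabs_def2 in hN; unfold P; lra. }
assert (exists N, forall n, (N <= n)%nat -> (Cmod (u n - 1) <= / 2)%R) as [N2 hN2].
{ pose proof (Clim_Cmod _ _ (Clim_minus _ _ _ _ hu (Clim_const 1))) as h.
  replace (1 - 1) with (RtoC 0) in h by ring; rewrite Cmod_0 in h.
  apply is_lim_seq_spec in h.
  assert (0 < / 2)%R as hh by lra.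
  destruct (h (mkposreal _ hh)) as [N hN]; exists N; intros n hn.
  specialize (hN n hn); simpl in hN; apply Rabs_def2 in hN; lra. }
(* From [K0] on, [K = INR (S k)] dominates [P], hence [Cmod (p n)] for large [n]. The denominator is
   then at least [2 K^2 - K^2], since [Cmod (u n) >= 1/2] and [w n k >= K]; the numerator is at most
   [2 (3/2 + 1) P], whence [c = 5 P]. *)
destruct (nfloor_ex P (Rlt_le _ _ hP)) as [K0 hK0].
apply Csum_dominated with (f := f) (m := fun n => (2 ^ n)%nat) (c := (5 * P)%R)
  (A := fun n => Ccoth x - (u n + 1) / p n + RtoC (/ r n) * ((u n - 1) / (u n + 1)))
  (K0 := K0) (N0 := (N1 + N2)%nat).
- lra.
- intros K; exists K; intros n hn.
  pose proof (Nat.pow_gt_lin_r 2 n ltac:(lia)); lia.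
- intros n k hn hk.
  specialize (hN1 n ltac:(lia)); specialize (hN2 n ltac:(lia)).
  assert (INR (S k) <= INR (2 ^ n))%R as hk1 by (apply le_INR; lia).
  assert (INR (2 ^ n) = r n / 2)%R as e
    by (rewrite pow_INR; unfold r; simpl (INR 2);
        replace (1 + 1)%R with 2%R by ring; simpl; field).
  rewrite e in hk1.
  assert (P <= INR (S k))%R as hPk.
  { apply Rle_trans with (INR K0 + 1)%R; [lra |].
    rewrite <- S_INR; apply le_INR; lia. }
  assert (/ 2 <= Cmod (u n) <= 3 / 2)%R as hun.
  { pose proof (Cmod_triangle_sub 1 (1 - u n)) as t1.
    replace (1 - (1 - u n)) with (u n) in t1 by ring.
    replace (1 - u n) with (- (u n - 1)) in t1 by ring; rewrite Cmod_opp, Cmod_1 in t1.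
    pose proof (Cmod_triangle 1 (u n - 1)) as t2.
    replace (1 + (u n - 1)) with (u n) in t2 by ring; rewrite Cmod_1 in t2; lra. }
  (* Here the range [k < 2^n] matters: it keeps the angle at most [PI / 2]. *)
  assert (INR (S k) <= w n k)%R as hwk.
  { assert (3 < PI)%R by (pose proof PI2_3_2; lra); specialize (hr n); set (K := INR (S k)) in *.
    assert (0 < K)%R by lra.
    unfold w; fold K; apply Rle_trans with (r n * (PI * K / r n / 3))%R.
    - replace (r n * (PI * K / r n / 3))%R with (PI / 3 * K)%R by (field; lra); nra.
    - apply Rmult_le_compat_l; [lra |]; apply sin_ge_third; split.
      + apply Rdiv_le_0_compat; [apply Rmult_le_pos; lra | exact hr].
      + apply Rmult_le_reg_r with (r n); [exact hr |].
        replace (PI * K / r n * r n)%R with (PI * K)%R by (field; lra).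
        replace (PI / 2 * r n)%R with (PI * (r n / 2))%R by field.
        apply Rmult_le_compat_l; lra. }
  set (K := INR (S k)) in *; assert (0 < K)%R as hK by lra.
  assert (K ^ 2 <= Cmod (p n * p n + 4 * u n * (w n k * w n k)))%R as hden.
  { pose proof (Cmod_triangle_sub (4 * u n * (w n k * w n k)) (- (p n * p n))) as t.
    replace (4 * u n * (w n k * w n k) - - (p n * p n)) with
      (p n * p n + 4 * u n * (w n k * w n k)) in t by ring.
    rewrite Cmod_opp, !Cmod_mult, !Cmod_R, (Rabs_pos_eq 4), (Rabs_pos_eq (w n k)) in t by lra.
    assert (Cmod (p n) * Cmod (p n) <= K * K)%R
      by (apply Rmult_le_compat; try apply Cmod_ge_0; lra).
    assert (K * K <= w n k * w n k)%R by (apply Rmult_le_compat; lra).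
    nra. }
  assert (0 < K ^ 2)%R as hK2 by (apply pow_lt; lra).
  unfold f; rewrite Cmod_div by (apply Cmod_gt_0; lra).
  unfold Rdiv; apply Rmult_le_compat.
  + apply Cmod_ge_0.
  + apply Rlt_le, Rinv_0_lt_compat; lra.
  + rewrite !Cmod_mult, Cmod_R, Rabs_pos_eq by lra.
    pose proof (Cmod_triangle (u n) 1) as t; rewrite Cmod_1 in t.
    pose proof (Cmod_ge_0 (p n)); pose proof (Cmod_ge_0 (u n + 1)); nra.
  + apply Rinv_le_contravar; lra.
- intros k.
  replace (Ccoth_term x k) with (2 * (1 + 1) * x /
    (x * x + 4 * 1 * ((PI * INR (S k))%R * (PI * INR (S k))%R))).
  + apply Clim_div.
    * replace (x * x + _) with (x * x + 4 * (PI * PI * (INR (S k) * INR (S k)))%R)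
        by (rewrite !RtoC_mult; ring).
      now apply Ccoth_term_den.
    * repeat apply Clim_mult; try apply Clim_const; [| exact hp].
      apply Clim_plus; [exact hu | apply Clim_const].
    * apply Clim_plus; [now apply Clim_mult |].
      apply Clim_mult; [apply Clim_mult; [apply Clim_const | exact hu] |].
      apply Clim_mult; apply hw.
  + unfold Ccoth_term; f_equal; [ring |]; f_equal; rewrite !RtoC_mult; ring.
- intros n; cbv beta.
  pose proof (Cexp_neq_1 _ (hxr n)) as hm; pose proof (Cexp_neq_m1 _ (hxr n)) as hq.
  fold (u n) in hm, hq; unfold p.
  apply (Cmult_cancel_l (r n)); [apply hrC |].
  rewrite <- Csum_scal.
  rewrite (Csum_ext _ (fun k => Ccoth (x / r n + Ci * (2 * PI * INR (S k) / r n)%R) +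
                 Ccoth (x / r n - Ci * (2 * PI * INR (S k) / r n)%R))).
  + pose proof (Ccoth_dyadic_sym n x hx) as e; fold (r n) in e.
    rewrite Ccoth_PI in e by apply hxr.
    change (Ccoth (x / r n)) with ((u n + 1) / (u n - 1)) in e; fold (u n) in e.
    match type of e with _ = ?a + ?s => transitivity (a + s - a); [| ring] end.
    rewrite <- e, RtoC_inv by (specialize (hr n); lra); field; repeat split; auto.
  + intros k _; rewrite Ccoth_pair by apply hxr; fold (u n).
    replace (2 * PI * INR (S k) / r n / 2)%R with (PI * INR (S k) / r n)%R
      by (field; specialize (hr n); lra).
    destruct (Ccoth_pair_neq_0 (x / r n) (2 * PI * INR (S k) / r n)%R (hxr n)) as [h1 h2].
    pose proof (Cmult_neq_0 _ _ h1 h2) as h; rewrite <- Ccoth_pair_factor in h; fold (u n) in h.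
    replace (2 * PI * INR (S k) / r n / 2)%R with (PI * INR (S k) / r n)%R in h
      by (field; specialize (hr n); lra).
    unfold f, p, w; rewrite !RtoC_mult in *.
    set (s := RtoC (sin _)) in *; specialize (hrC n); field; split; [exact h |].
    replace (_ + _) with (r n * r n * ((u n - 1) ^ 2 + 4 * u n * (s * s))) by ring.
    repeat apply Cmult_neq_0; assumption.
- replace (Ccoth x - 2 / x) with (Ccoth x - (1 + 1) / x + 0 * ((1 - 1) / (1 + 1)))
    by (field; exact hx0).
  apply Clim_plus.
  + apply Clim_minus; [apply Clim_const |].
    apply Clim_div; [exact hx0 | apply Clim_plus; [exact hu | apply Clim_const] | exact hp].
  + apply Clim_mult; [exact hri |].
    assert (Clim (fun _ => 1) 1) as h1 by apply Clim_const.
    apply Clim_div; [intros e; rewrite <- RtoC_plus in e; apply RtoC_inj in e; lra | |].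
    * now apply Clim_minus.
    * now apply Clim_plus.
Qed.

(** * Values of the zeta function and Bernoulli numbers *)

Definition zeta_nat (m : nat) : R := Series (fun k => / INR (S k) ^ m)%R.

Lemma INR_S_ge_1 (k : nat) : (1 <= INR (S k))%R.
Proof. apply (le_INR 1); lia. Qed.

Lemma inv_pow_le_square (k m : nat) : (2 <= m)%nat -> (/ INR (S k) ^ m <= / INR (S k) ^ 2)%R.
Proof.
intros hm; pose proof (INR_S_ge_1 k); apply Rinv_le_contravar.
- apply pow_lt; lra.
- now apply Rle_pow.
Qed.

Lemma inv_pow_pos (k m : nat) : (0 < / INR (S k) ^ m)%R.
Proof. apply Rinv_0_lt_compat, pow_lt, lt_0_INR; lia. Qed.

Lemma Clim_zeta_nat (m : nat) : (2 <= m)%nat ->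
  Clim (Csum (fun k => RtoC (/ INR (S k) ^ m)%R)) (zeta_nat m).
Proof.
intros hm; destruct (Csum_converges (fun k => RtoC (/ INR (S k) ^ m)%R) 1) as [l hl].
- lra.
- intros k; rewrite Cmod_R, Rabs_pos_eq by (apply Rlt_le, inv_pow_pos).
  unfold Rdiv; rewrite Rmult_1_l; now apply inv_pow_le_square.
- replace (RtoC (zeta_nat m)) with l; [exact hl |].
  rewrite <- (CSeries_unique _ _ hl); unfold CSeries; simpl Re; simpl Im.
  apply injective_projections; [reflexivity |].
  apply is_series_unique; change (is_lim_seq (sum_n (fun _ => 0%R)) 0%R).
  apply (is_lim_seq_ext (fun _ => 0%R)); [| apply is_lim_seq_const].
  intros n; rewrite sum_n_const; ring.
Qed.

Lemma zeta_nat_ge_1 (m : nat) : (2 <= m)%nat -> (1 <= zeta_nat m)%R.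
Proof.
intros hm; destruct (Clim_zeta_nat m hm) as [h _].
apply (is_lim_seq_le_loc (fun _ => 1%R)
  (fun n => Re (Csum (fun k => RtoC (/ INR (S k) ^ m)%R) n)) 1%R (zeta_nat m));
  [| apply is_lim_seq_const | exact h].
exists 1%nat; intros n hn; induction hn as [|n hn IH].
- simpl; rewrite pow1; lra.
- rewrite Csum_S; eapply Rle_trans; [exact IH |].
  pose proof (inv_pow_pos n m).
  change (Re (Csum (fun k => RtoC (/ INR (S k) ^ m)%R) n) <=
    Re (Csum (fun k => RtoC (/ INR (S k) ^ m)%R) n) + / INR (S n) ^ m)%R; lra.
Qed.

(** Convergence at [- d / 2] gives a positive radius, so the sum is continuous at 0 and its value
    there is the limit along [- (d / 2) / 2^n]. *)
Lemma pseries_left_zero_coeff (a : nat -> R) (d : R) : (0 < d)%R ->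
  (forall t, (- d < t < 0)%R -> is_pseries a t 0%R) -> a O = 0%R.
Proof.
intros hd h.
assert (Rbar_lt (Rabs 0) (CV_radius a)) as hr.
{ apply Rbar_lt_le_trans with (Rabs (- (d / 2))).
  - rewrite Rabs_R0; simpl; apply Rabs_pos_lt; lra.
  - apply Rbar_not_lt_le; intros hc; apply (CV_disk_outside _ _ hc).
    apply ex_series_lim_0; exists 0%R.
    apply is_pseries_R, h; lra. }
pose proof (is_lim_seq_continuous (PSeries a) (fun n => - (d / 2) * / 2 ^ n)%R 0%R
  (PSeries_continuity a 0 hr)) as hc.
rewrite PSeries_0 in hc.
assert (is_lim_seq (fun _ => 0%R) (a O)) as h0.
{ eapply is_lim_seq_ext; [| apply hc].
  - intros n; apply is_pseries_unique, h.
    assert (0 < / 2 ^ n <= 1)%R; [| nra].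
    pose proof (pow2_pos n); split; [now apply Rinv_0_lt_compat |].
    rewrite <- Rinv_1; apply Rinv_le_contravar; [lra |]; apply pow_R1_Rle; lra.
  - replace 0%R with (- (d / 2) * 0)%R by ring.
    apply (is_lim_seq_scal_l _ _ 0%R), is_lim_seq_inv_pow2. }
apply is_lim_seq_unique in h0; rewrite Lim_seq_const in h0; now injection h0.
Qed.

(** A one-sided punctured interval suffices, because division by [t] shifts the coefficients down.
    This form fits both uses: the generating series of the Bernoulli numbers is given only for
    [t <> 0], and in the continuation argument vanishing is known only on the left of a supremum. *)
Lemma pseries_left_zero (a : nat -> R) (d : R) : (0 < d)%R ->
  (forall t, (- d < t < 0)%R -> is_pseries a t 0%R) -> forall k, a k = 0%R.
Proof.
intros hd h k; revert a h; induction k as [|k IH]; intros a h.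
- now apply pseries_left_zero_coeff with d.
- change (PS_decr_1 a k = 0%R); apply IH; intros t ht.
  replace 0%R with (scal (/ t)%R (plus 0%R (opp (a O)))).
  + apply (@is_pseries_decr_1 R_AbsRing R_NormedModule a t (/ t)%R 0%R); [| now apply h].
    unfold mult, one; simpl; field; lra.
  + rewrite (pseries_left_zero_coeff a d hd h).
    unfold scal, plus, opp; simpl; unfold mult; simpl; ring.
Qed.

(** The candidate for [B_m / m!], with Euler's formula [B_(2j) / (2j)! = - 2 (-1)^j zeta(2j) / (2
    pi)^(2j)] taken as the definition. *)
Definition bernoulli_coeff (m : nat) : R :=
  match m with
  | O => 1
  | 1%nat => - / 2
  | _ => if Nat.even m then - 2 * (-1) ^ (m / 2) * zeta_nat m / (2 * PI) ^ m else 0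
  end%R.

Lemma bernoulli_coeff_even (j : nat) :
  bernoulli_coeff (2 * S j) =
  (2 * (-1) ^ j * zeta_nat (2 * S j) / (2 * PI) ^ (2 * S j))%R.
Proof.
unfold bernoulli_coeff.
replace (2 * S j / 2)%nat with (S j) by (rewrite Nat.mul_comm, Nat.div_mul; lia).
replace (Nat.even (2 * S j)) with true by (symmetry; apply Nat.even_spec; exists (S j); lia).
destruct (2 * S j)%nat as [|[|m]] eqn:e; [lia | lia |].
simpl ((-1) ^ S j)%R; unfold Rdiv; ring.
Qed.

Lemma bernoulli_coeff_odd (j : nat) : bernoulli_coeff (2 * S j + 1) = 0%R.
Proof.
unfold bernoulli_coeff.
replace (Nat.even (2 * S j + 1)) with false
  by (symmetry; rewrite <- Nat.negb_odd, (proj2 (Nat.odd_spec _)); [reflexivity | exists (S j); lia]).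
destruct (2 * S j + 1)%nat as [|[|m]] eqn:e; [lia | lia | reflexivity].
Qed.

(** The remainder is kept explicit, so that expansions truncated at the same order can be summed
    over many [y]. *)
Lemma Csum_alternating_geometric (y : C) (J : nat) : 1 + y <> 0 ->
  2 * y / (1 + y) - Csum (fun j => 2 * ((-1) ^ j)%R * (y * y ^ j)) J =
  2 * ((-1) ^ J)%R * (y * y ^ J) / (1 + y).
Proof.
intros hy; induction J as [|J IH].
- simpl; field; exact hy.
- rewrite Csum_S.
  match goal with |- ?a - (?b + ?c) = _ => replace (a - (b + c)) with (a - b - c) by ring end.
  rewrite IH; simpl ((-1) ^ S J)%R; rewrite Cpow_S, RtoC_mult; field; exact hy.
Qed.

Lemma pow_2S (x : R) (j : nat) : (x ^ (2 * S j) = x ^ 2 * (x ^ 2) ^ j)%R.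
Proof. rewrite pow_mult; reflexivity. Qed.

(** Put [x = (t / (2 PI))^2] and [y_k = x / k^2]. The [k]-th partial fraction times [t / 2] is
    [2 y_k / (1 + y_k)]; expanded to order [J], its remainder is at most
    [2 y_k^(J+1) <= 2 x^(J+1) / k^2], and summation over [k] doubles the constant. The sums over [j]
    and [k] are exchanged while both are finite. *)
Lemma bernoulli_even_bound (t : R) (J : nat) : t <> 0%R ->
  (Cmod (t / 2 * (Ccoth t - 2 / t) -
     Csum (fun j => RtoC (bernoulli_coeff (2 * S j) * (t ^ 2) ^ S j)%R) J)
   <= 4 * ((t / (2 * PI)) ^ 2) ^ S J)%R.
Proof.
intros ht; pose proof PI_RGT_0 as hpi.
assert (RtoC t <> 0) as htC by now apply RtoC_neq_0.
set (x := ((t / (2 * PI)) ^ 2)%R).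
assert (0 < x)%R as hx.
{ apply pow2_gt_0; unfold Rdiv; apply Rmult_integral_contrapositive; split; [exact ht |].
  apply Rinv_neq_0_compat; lra. }
set (y := fun k => (x * / INR (S k) ^ 2)%R).
assert (forall k, (0 < y k)%R) as hy
  by (intros k; apply Rmult_lt_0_compat; [exact hx | apply inv_pow_pos]).
assert (forall k, 1 + y k <> 0) as hyC.
{ intros k; rewrite <- RtoC_plus; apply RtoC_neq_0; specialize (hy k); lra. }
pose proof (Ccoth_partial_fractions t ht) as hT.
apply Clim_Cmod_le with (N := O) (u := fun K =>
  t / 2 * Csum (Ccoth_term t) K -
  Csum (fun j => 2 * ((-1) ^ j)%R * RtoC (x ^ S j)%R *
    Csum (fun k => RtoC (/ INR (S k) ^ (2 * S j))%R) K) J).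
- apply Clim_minus; [apply Clim_mult; [apply Clim_const | exact hT] |].
  induction J as [|J IH]; [apply Clim_const |].
  apply Clim_plus; [exact IH |].
  replace (RtoC (bernoulli_coeff (2 * S J) * (t ^ 2) ^ S J)%R) with
    (2 * ((-1) ^ J)%R * RtoC (x ^ S J)%R * zeta_nat (2 * S J)).
  + apply Clim_mult; [apply Clim_const | apply Clim_zeta_nat; lia].
  + rewrite bernoulli_coeff_even, <- !RtoC_mult; f_equal; unfold x.
    rewrite <- !pow_mult; unfold Rdiv at 1; rewrite Rpow_mult_distr, pow_inv.
    field; apply pow_nonzero; lra.
- intros K _.
  rewrite <- Csum_scal.
  rewrite (Csum_ext (fun j => 2 * ((-1) ^ j)%R * RtoC (x ^ S j)%R * Csum _ K) (fun j => Csum (fun k =>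
    2 * ((-1) ^ j)%R * (y k * RtoC (y k) ^ j)) K)).
  2: { intros j _; rewrite <- Csum_scal; apply Csum_ext; intros k _.
    rewrite <- RtoC_pow, <- !RtoC_mult; f_equal; unfold y.
    rewrite Rpow_mult_distr, pow_2S, Rinv_mult, pow_inv; simpl (x ^ S j)%R; ring. }
  rewrite Csum_exchange, <- Csum_minus.
  rewrite (Csum_ext _ (fun k => 2 * ((-1) ^ J)%R * (y k * RtoC (y k) ^ J) / (1 + y k))).
  2: { intros k _; rewrite <- Csum_alternating_geometric by apply hyC; f_equal.
    unfold Ccoth_term.
    assert (0 < INR (S k))%R as hk by (apply lt_0_INR; lia).
    assert (t * t + 4 * (PI * PI * (INR (S k) * INR (S k))) <> 0)%R as hd.
    { assert (0 < t * t)%R by nra; assert (0 < PI * PI * (INR (S k) * INR (S k)))%R; [| lra].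
      apply Rmult_lt_0_compat; apply Rmult_lt_0_compat; lra. }
    specialize (hy k).
    rewrite <- !RtoC_mult, <- !RtoC_plus, <- !RtoC_div, <- !RtoC_mult by lra.
    unfold y, x in hy |- *; set (d := INR (S k)) in *; clearbody d.
    f_equal; simpl; field; repeat split; lra. }
  replace (4 * x ^ S J)%R with (2 * (2 * x ^ S J))%R by ring.
  pose proof (pow_lt x (S J) hx) as hxJ.
  apply Csum_bound; [lra |].
  intros k _; specialize (hy k).
  rewrite <- RtoC_pow, <- RtoC_plus, <- !RtoC_mult, <- RtoC_div, Cmod_R by lra.
  unfold Rdiv; rewrite Rabs_mult, (Rabs_mult _ (y k * _)), (Rabs_mult 2), pow_1_abs, (Rabs_pos_eq 2), (Rabs_pos_eq (/ _)).
  + assert (y k ^ S J <= x ^ S J * / INR (S k) ^ 2)%R as h1.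
    { unfold y; rewrite Rpow_mult_distr, pow_inv, <- pow_mult.
      apply Rmult_le_compat_l; [lra |]; apply inv_pow_le_square; lia. }
    pose proof (pow_lt (y k) (S J) hy) as h2.
    change (y k * y k ^ J)%R with (y k ^ S J)%R; rewrite Rabs_pos_eq by lra.
    assert (/ (1 + y k) <= 1)%R as h3
      by (rewrite <- Rinv_1 at 2; apply Rinv_le_contravar; lra).
    assert (0 < / (1 + y k))%R as h4 by (apply Rinv_0_lt_compat; lra).
    apply Rle_trans with (2 * y k ^ S J)%R; [nra | lra].
  + apply Rlt_le, Rinv_0_lt_compat; lra.
  + lra.
Qed.

(** The function is [(t/2) coth (t/2) - t/2]: the even coefficients come from the bound above, whose
    ratio [(t / (2 PI))^2] is below 1, and the odd part is the single term [- t/2]. *)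
Lemma bernoulli_coeff_pseries (t : R) : t <> 0%R -> (Rabs t < 1)%R ->
  is_pseries bernoulli_coeff t (t / (exp t - 1))%R.
Proof.
intros ht ht1.
assert (exp t - 1 <> 0)%R as he.
{ intros e; apply ht, exp_inv; rewrite exp_0; lra. }
replace (t / (exp t - 1))%R with
  ((t / 2 * ((exp t + 1) / (exp t - 1))) + t * (- / 2))%R by (field; exact he).
apply is_pseries_odd_even.
- apply is_pseries_R.
  change (is_lim_seq (sum_n (fun k => bernoulli_coeff (2 * k) * (t ^ 2) ^ k)%R)
    (t / 2 * ((exp t + 1) / (exp t - 1)))%R).
  assert (Clim (fun J => 1 + Csum (fun j => RtoC (bernoulli_coeff (2 * S j) * (t ^ 2) ^ S j)%R) J)
    (t / 2 * ((exp t + 1) / (exp t - 1)))%R) as [h _].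
  { apply Clim_bound with (e := fun J => (4 * ((t / (2 * PI)) ^ 2) ^ S J)%R) (N := O).
    - intros J _; eapply Rle_trans; [| apply bernoulli_even_bound, ht].
      apply Req_le; rewrite <- Cmod_opp; f_equal.
      assert (RtoC t <> 0) as htC by now apply RtoC_neq_0.
      replace (Ccoth t) with (RtoC ((exp t + 1) / (exp t - 1))%R).
      + rewrite RtoC_mult, (RtoC_div t 2) by lra; field; exact htC.
      + unfold Ccoth; rewrite Cexp_RtoC, RtoC_div, RtoC_plus, RtoC_minus by exact he; reflexivity.
    - replace 0%R with (4 * 0)%R by ring.
      apply (is_lim_seq_scal_l _ _ 0%R).
      apply (is_lim_seq_incr_1 (fun J => ((t / (2 * PI)) ^ 2) ^ J)%R), is_lim_seq_geom.
      rewrite <- RPow_abs; unfold Rdiv; rewrite Rabs_mult.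
      pose proof PI2_3_2; rewrite (Rabs_pos_eq (/ _)) by (apply Rlt_le, Rinv_0_lt_compat; lra).
      assert (/ (2 * PI) < 1)%R.
      { rewrite <- Rinv_1; apply Rinv_lt_contravar; lra. }
      assert (0 < / (2 * PI))%R by (apply Rinv_0_lt_compat; lra).
      assert (0 <= Rabs t * / (2 * PI) < 1)%R; [| simpl; nra].
      pose proof (Rabs_pos t); split; [nra |].
      apply Rlt_trans with (1 * / (2 * PI))%R; [nra | lra]. }
  revert h; apply is_lim_seq_ext; intros J.
  rewrite <- (sum_n_ext (fun k => Re (RtoC (bernoulli_coeff (2 * k) * (t ^ 2) ^ k)%R))) by reflexivity.
  rewrite <- Re_Csum, Csum_first.
  f_equal; f_equal; simpl; f_equal; ring.
- apply is_pseries_R.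
  change (is_lim_seq (sum_n (fun k => bernoulli_coeff (2 * k + 1) * (t ^ 2) ^ k)%R) (- / 2)%R).
  apply (is_lim_seq_ext (fun _ => - / 2)%R); [| apply is_lim_seq_const].
  intros n; induction n as [|n IH].
  + rewrite sum_O; simpl; ring.
  + rewrite sum_Sn, <- IH, bernoulli_coeff_odd; unfold plus; simpl; ring.
Qed.

(** The right-hand side witnesses [is_bernoulli], so the chosen sequence satisfies it too; the
    difference of the two series vanishes on a left neighbourhood of 0. *)
Lemma bernoulli_value (m : nat) : (bernoulli m = INR (fact m) * bernoulli_coeff m)%R.
Proof.
assert (forall m, INR (fact m) <> 0%R) as hf by (intros; apply INR_fact_neq_0).
assert (is_bernoulli bernoulli) as [r [hr h]].
{ unfold bernoulli; apply epsilon_spec.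
  exists (fun m => INR (fact m) * bernoulli_coeff m)%R, 1%R; split; [lra |].
  intros t ht ht1.
  apply (is_pseries_ext bernoulli_coeff); [| now apply bernoulli_coeff_pseries].
  intros k; apply Rmult_eq_reg_r with (INR (fact k)); [field |]; apply hf. }
assert (bernoulli m / INR (fact m) - bernoulli_coeff m = 0)%R as e.
{ apply (pseries_left_zero (fun m => bernoulli m / INR (fact m) - bernoulli_coeff m)%R (Rmin r 1)).
  - apply Rmin_pos; lra.
  - intros t ht.
    pose proof (Rmin_l r 1); pose proof (Rmin_r r 1).
    assert (Rabs t < r)%R by (rewrite Rabs_left; lra).
    assert (Rabs t < 1)%R by (rewrite Rabs_left; lra).
    replace 0%R with (minus (t / (exp t - 1)) (t / (exp t - 1)))%R by (unfold minus, plus, opp; simpl; ring).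
    apply (is_pseries_minus (fun m => bernoulli m / INR (fact m))%R bernoulli_coeff).
    + apply h; lra.
    + apply bernoulli_coeff_pseries; lra. }
specialize (hf m).
replace (bernoulli_coeff m) with (bernoulli m / INR (fact m))%R by lra; field; exact hf.
Qed.

(** * The Lambert series as a sum of cotangents *)

Lemma Cexp_INR_mult (m : nat) (x : C) : Cexp (INR m * x) = Cexp x ^ m.
Proof.
induction m as [|m IH].
- simpl; replace (0 * x) with (RtoC 0) by ring; apply Cexp_0.
- rewrite S_INR, RtoC_plus, Cpow_S, <- IH, <- Cexp_plus; f_equal; ring.
Qed.

Lemma Clog_RtoC (x : R) : (0 < x)%R -> Clog x = RtoC (ln x).
Proof.
intros hx; unfold Clog, Carg; rewrite Cmod_R, Rabs_pos_eq by lra; simpl.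
destruct (Rle_dec 0 0) as [_|h]; [| lra].
replace (x / x)%R with 1%R by (field; lra); now rewrite acos_1.
Qed.

Lemma Cpower_RtoC_INR (x : R) (m : nat) : (0 < x)%R -> Cpower x (INR m) = RtoC (x ^ m)%R.
Proof.
intros hx; unfold Cpower; rewrite Clog_RtoC, <- RtoC_mult, Cexp_RtoC by exact hx.
rewrite <- Rpower_pow by exact hx; reflexivity.
Qed.

Lemma Cpower_RtoC_opp_INR (x : R) (m : nat) :
  (0 < x)%R -> Cpower x (- INR m) = RtoC (/ x ^ m)%R.
Proof.
intros hx; unfold Cpower.
rewrite Clog_RtoC, <- RtoC_opp, <- RtoC_mult, Cexp_RtoC by exact hx.
rewrite <- Rpower_pow by exact hx; unfold Rpower.
now rewrite <- exp_Ropp, Ropp_mult_distr_l.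
Qed.

Lemma zeta_INR (m : nat) : (2 <= m)%nat -> zeta (INR m) = RtoC (zeta_nat m).
Proof.
intros hm; unfold zeta; simpl Re.
destruct (Rlt_dec 1 (INR m)) as [_|h].
- apply CSeries_unique.
  apply Clim_ext with (2 := Clim_zeta_nat m hm).
  intros N; apply Csum_ext; intros k _.
  rewrite Cpower_RtoC_INR by (apply lt_0_INR; lia).
  apply RtoC_inv, pow_nonzero, not_0_INR; lia.
- exfalso; apply h, (lt_INR 1); lia.
Qed.

Lemma sum_n_m_Csum (f : nat -> C) (N : nat) : sum_n_m f 1 N = Csum (fun i => f (S i)) N.
Proof.
induction N as [|N IH].
- rewrite sum_n_m_zero by lia; reflexivity.
- rewrite sum_n_Sm, IH by lia; reflexivity.
Qed.

(** Integers larger than [S k] do not divide it, so the range of divisors can be extended to a bound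
    common to all [k < N]; the sums over [k] and over divisors then commute. *)
Lemma divisor_sigma_Csum (n k N : nat) : (k < N)%nat ->
  divisor_sigma (- INR n) (S k) =
  Csum (fun i => if (S k mod S i =? 0)%nat then RtoC (/ INR (S i) ^ n)%R else 0) N.
Proof.
intros hk; unfold divisor_sigma; rewrite sum_n_m_Csum.
replace N with (S k + (N - S k))%nat by lia; rewrite Csum_add.
rewrite (Csum_zero (fun i => if (S k mod S (S k + i) =? 0)%nat then _ else _)).
- rewrite Cplus_0_r; apply Csum_ext; intros i _.
  rewrite Cpower_RtoC_opp_INR by (apply lt_0_INR; lia); reflexivity.
- intros i _; rewrite Nat.mod_small by lia; reflexivity.
Qed.

(** A geometric sum over the multiples of [d] up to [N], of which there are [N / d]. *)
Lemma Csum_multiples (q : C) (d N : nat) : (0 < d)%nat ->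
  (1 - q ^ d) * Csum (fun k => if (S k mod d =? 0)%nat then q ^ S k else 0) N =
  q ^ d - q ^ (d * (N / d) + d).
Proof.
intros hd; induction N as [|N IH].
- rewrite Nat.Div0.div_0_l, Nat.mul_0_r; simpl; ring.
- rewrite Csum_S, Cmult_plus_distr_l, IH.
  pose proof (Nat.div_mod_eq N d) as e; pose proof (Nat.mod_upper_bound N d ltac:(lia)) as hb.
  destruct (Nat.eqb_spec (S N mod d) 0) as [h|h].
  + pose proof (Nat.div_mod_eq (S N) d) as e'; rewrite h in e'.
    assert (S N / d = S (N / d))%nat as e1 by nia.
    rewrite e1; rewrite e1 in e'; rewrite e' at 1.
    replace (d * S (N / d) + 0)%nat with (d * (N / d) + d)%nat by lia.
    replace (d * S (N / d) + d)%nat with (d + (d * (N / d) + d))%nat by lia.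
    rewrite (Cpow_add_r q d (d * (N / d) + d)); ring.
  + replace (S N / d)%nat with (N / d)%nat; [ring |].
    apply (Nat.div_unique (S N) d (N / d) (S (N mod d))); [| lia].
    assert (S (N mod d) <> d); [| lia].
    intros e2; apply h; replace (S N) with ((N / d + 1) * d)%nat
      by (rewrite Nat.mul_add_distr_r, (Nat.mul_comm (N / d)); lia).
    apply Nat.Div0.mod_mul.
Qed.

Lemma one_sub_pow_bound (q : C) (d : nat) : (Cmod q < 1)%R ->
  (1 - Cmod q <= Cmod (1 - q ^ S d))%R.
Proof.
intros hq; pose proof (Cmod_triangle_sub 1 (q ^ S d)) as h; rewrite Cmod_1, Cmod_pow in h.
pose proof (Cmod_ge_0 q).
assert (Cmod q ^ d <= 1)%R by (rewrite <- (pow1 d); apply pow_incr; lra).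
change (Cmod q ^ S d)%R with (Cmod q * Cmod q ^ d)%R in h; nra.
Qed.

Lemma pow_le_1_compat (x : R) (a b : nat) :
  (0 <= x <= 1)%R -> (a <= b)%nat -> (x ^ b <= x ^ a)%R.
Proof.
intros hx hab; replace b with (a + (b - a))%nat by lia; rewrite pow_add.
pose proof (pow_le x a (proj1 hx)).
assert (x ^ (b - a) <= 1)%R by (rewrite <- (pow1 (b - a)); now apply pow_incr).
nra.
Qed.

(** Grouping the pairs divisor-multiple by divisor turns the truncated divisor series into truncated
    geometric series. What each of them misses is at most [|q|^N / (1 - |q|) / d^2], so the two
    partial sums have the same limit. *)
Lemma lambert_series (n : nat) (q : C) : (2 <= n)%nat -> (Cmod q < 1)%R ->
  exists l : C,
    Clim (Csum (fun d => RtoC (/ INR (S d) ^ n)%R * (q ^ S d / (1 - q ^ S d)))) l /\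
    Clim (Csum (fun k => divisor_sigma (- INR n) (S k) * q ^ S k)) l.
Proof.
intros hn hq; pose proof (Cmod_ge_0 q) as hq0.
assert (0 < / (1 - Cmod q))%R as hc by (apply Rinv_0_lt_compat; lra).
assert (forall d, 1 - q ^ S d <> 0) as hd.
{ intros d; apply Cmod_gt_0; pose proof (one_sub_pow_bound q d hq); lra. }
(* The exponent [a] is free: [S d] gives convergence, and the first multiple of [S d] beyond [N]
   gives the missing tail. *)
assert (forall d (a : nat), (Cmod (RtoC (/ INR (S d) ^ n)%R * (q ^ a / (1 - q ^ S d))) <=
  Cmod q ^ a * / (1 - Cmod q) / INR (S d) ^ 2)%R) as hb.
{ intros d a; rewrite Cmod_mult, Cmod_R, Rabs_pos_eq by (apply Rlt_le, inv_pow_pos).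
  rewrite Rmult_comm; unfold Rdiv; apply Rmult_le_compat.
  - apply Cmod_ge_0.
  - apply Rlt_le, inv_pow_pos.
  - rewrite Cmod_div, Cmod_pow by apply hd; unfold Rdiv.
    apply Rmult_le_compat_l; [now apply pow_le |].
    apply Rinv_le_contravar; [lra | now apply one_sub_pow_bound].
  - now apply inv_pow_le_square. }
destruct (Csum_converges (fun d => RtoC (/ INR (S d) ^ n)%R * (q ^ S d / (1 - q ^ S d)))
  (/ (1 - Cmod q))) as [l hl].
- lra.
- intros d; eapply Rle_trans; [apply hb |].
  unfold Rdiv; apply Rmult_le_compat_r; [apply Rlt_le, inv_pow_pos |].
  assert (Cmod q ^ S d <= 1)%R by (rewrite <- (pow1 (S d)); apply pow_incr; lra).
  nra.
- exists l; split; [exact hl |].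
  apply Clim_of_diff with (2 := hl).
  apply Clim_0_bound with (e := fun N => (2 * (Cmod q ^ N * / (1 - Cmod q)))%R) (N := O).
  + intros N _.
    rewrite (Csum_ext (fun k => divisor_sigma _ _ * _) (fun k => Csum (fun i =>
      if (S k mod S i =? 0)%nat then RtoC (/ INR (S i) ^ n)%R * q ^ S k else 0) N)).
    2: { intros k hk; rewrite (divisor_sigma_Csum n k N hk), Cmult_comm, <- Csum_scal.
      apply Csum_ext; intros i _; destruct (_ =? _)%nat; ring. }
    rewrite Csum_exchange, <- Csum_minus.
    apply Csum_bound.
    * apply Rmult_le_pos; [now apply pow_le | lra].
    * intros d _.
      apply Rle_trans with (2 := Rmult_le_compat_r _ _ _
        (Rlt_le _ _ (inv_pow_pos d 2)) (Rmult_le_compat_r _ _ _ (Rlt_le _ _ hc)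
        (pow_le_1_compat (Cmod q) N (S d * (N / S d) + S d) ltac:(lra)
          ltac:(pose proof (Nat.div_mod_eq N (S d));
                pose proof (Nat.mod_upper_bound N (S d) ltac:(lia)); lia)))).
      eapply Rle_trans; [| apply hb].
      apply Req_le; rewrite <- Cmod_opp; f_equal.
      rewrite (Csum_ext _ (fun k => RtoC (/ INR (S d) ^ n)%R *
        (if (S k mod S d =? 0)%nat then q ^ S k else 0)))
        by (intros k _; destruct (_ =? _)%nat; ring).
      rewrite Csum_scal.
      pose proof (Csum_multiples q (S d) N ltac:(lia)) as e.
      specialize (hd d).
      replace (q ^ (S d * (N / S d) + S d)) with
        (q ^ S d - (q ^ S d - q ^ (S d * (N / S d) + S d))) by ring.
      rewrite <- e; field; exact hd.
  + replace 0%R with (2 * (0 * / (1 - Cmod q)))%R by ring.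
    apply (is_lim_seq_scal_l _ _ (0 * / (1 - Cmod q))%R).
    apply (is_lim_seq_scal_r _ _ 0%R), is_lim_seq_geom.
    rewrite Rabs_pos_eq; lra.
Qed.

(** Its exponential is the inverse of the power [q^(d+1)] of [q = e^(2 pi i z)]; on the upper
    half-plane its real part is positive. *)
Definition coth_arg (z : C) (d : nat) : C := - (Ci * (2 * PI * INR (S d))%R * z).

(** Each cotangent is [1 + 2 q^d / (1 - q^d)]: the ones sum to [zeta(n)], matching the constant term
    of [E], and the rest is the Lambert series. *)
Lemma E_coth_series (n : nat) (z : C) : (2 <= n)%nat -> (0 < Im z)%R ->
  Clim (Csum (fun d => RtoC (/ INR (S d) ^ n)%R * Ccoth (coth_arg z d)))
    (zeta_nat n * E (- INR n) z).
Proof.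
intros hn hz; pose proof PI_RGT_0 as hpi.
set (q := Cexp (Ci * (2 * PI)%R * z)).
assert (Cmod q < 1)%R as hq.
{ unfold q; rewrite Cmod_Cexp, <- exp_0; apply exp_increasing.
  destruct z as [x y]; simpl in *; nra. }
destruct (lambert_series n q hn hq) as [l [h1 h2]].
assert (RtoC (zeta_nat n) <> 0) as hzn
  by (apply RtoC_neq_0; pose proof (zeta_nat_ge_1 n hn); lra).
replace (zeta_nat n * E (- INR n) z) with (zeta_nat n + 2 * l).
- apply Clim_ext with (fun N => Csum (fun k => RtoC (/ INR (S k) ^ n)%R) N +
    2 * Csum (fun d => RtoC (/ INR (S d) ^ n)%R * (q ^ S d / (1 - q ^ S d))) N).
  + intros N; rewrite <- Csum_scal, <- Csum_plus; apply Csum_ext; intros d _.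
    assert (1 - q ^ S d <> 0) as hd.
    { apply Cmod_gt_0; pose proof (one_sub_pow_bound q d hq); lra. }
    assert (q ^ S d * Cexp (coth_arg z d) = 1) as e.
    { unfold q; rewrite <- Cexp_INR_mult, <- (Cexp_opp_r (INR (S d) * (Ci * (2 * PI)%R * z))).
      f_equal; f_equal; unfold coth_arg; rewrite !RtoC_mult; ring. }
    unfold Ccoth.
    assert (q ^ S d <> 0) as hq0 by (apply Cpow_nz, Cexp_neq_0).
    replace (Cexp (coth_arg z d)) with (/ q ^ S d).
    * field; repeat split; auto.
    * apply (Cmult_cancel_l (q ^ S d) _ _ hq0); rewrite e; field; exact hq0.
  + apply Clim_plus; [now apply Clim_zeta_nat |].
    apply Clim_mult; [apply Clim_const | exact h1].
- unfold E; replace (- - INR n) with (RtoC (INR n)) by ring; rewrite zeta_INR by exact hn.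
  rewrite (CSeries_unique _ l); [field; exact hzn |].
  apply Clim_ext with (2 := h2); intros N; apply Csum_ext; intros k _; f_equal.
  unfold q; rewrite <- Cexp_INR_mult; f_equal; rewrite RtoC_mult; ring.
Qed.

Lemma Re_coth_arg (z : C) (d : nat) : Re (coth_arg z d) = (2 * PI * INR (S d) * Im z)%R.
Proof. unfold coth_arg; generalize (2 * PI * INR (S d))%R; intros r; destruct z; simpl; ring. Qed.

Lemma Re_coth_arg_neq_0 (z : C) (d : nat) : (0 < Im z)%R -> Re (coth_arg z d) <> 0%R.
Proof.
intros hz; rewrite Re_coth_arg; pose proof PI_RGT_0.
assert (0 < INR (S d))%R by (apply lt_0_INR; lia).
assert (0 < 2 * PI * INR (S d) * Im z)%R; [| lra].
apply Rmult_lt_0_compat; [apply Rmult_lt_0_compat; lra | exact hz].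
Qed.

(** The left-hand side is the absolute value of the imaginary part of [Cconj x * (x + Ci * y)]. *)
Lemma Cmod_add_imaginary (x : C) (y : R) :
  (Rabs y * Rabs (Re x) <= Cmod x * Cmod (x + Ci * y))%R.
Proof.
rewrite <- (Cmod_conj x), <- Cmod_mult, <- Rabs_mult.
eapply Rle_trans; [| apply Im_le_Cmod].
apply Req_le; f_equal; destruct x; simpl; ring.
Qed.

(** The denominator factors as [(x + 2 pi i k) (x - 2 pi i k)], and the previous inequality for both
    factors gives [(2 pi k)^2 (Re x)^2 <= |x|^2 |D|]. At [coth_arg z d], where both [|x|] and [Re x]
    are proportional to [d + 1], the bound grows only linearly in [d]. *)
Lemma Ccoth_term_bound (x : C) (k : nat) : Re x <> 0%R ->
  (Cmod (Ccoth_term x k) <= Cmod x ^ 3 / (Re x) ^ 2 / INR (S k) ^ 2)%R.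
Proof.
intros hx; pose proof (Ccoth_term_den x k hx) as hd; unfold Ccoth_term.
rewrite Cmod_div by exact hd.
apply Cmod_gt_0 in hd.
assert (0 < Cmod x)%R as hx0
  by (apply Cmod_gt_0; intros e; apply hx; rewrite e; reflexivity).
set (K := INR (S k)) in *.
assert (0 < K)%R as hK by (apply lt_0_INR; lia).
assert (3 < PI)%R by (pose proof PI2_3_2; lra).
assert (0 < Re x ^ 2)%R as hx2 by now apply pow2_gt_0.
assert ((2 * PI * K) ^ 2 * Re x ^ 2 <=
  Cmod x ^ 2 * Cmod (x * x + 4 * (PI * PI * (K * K))%R))%R as h.
{ replace (x * x + 4 * (PI * PI * (K * K))%R) with
    ((x + Ci * (2 * PI * K)%R) * (x + Ci * (- (2 * PI * K))%R))
    by (apply injective_projections; simpl; ring).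
  rewrite Cmod_mult.
  pose proof (Cmod_add_imaginary x (2 * PI * K)) as t1.
  pose proof (Cmod_add_imaginary x (- (2 * PI * K))) as t2.
  rewrite Rabs_Ropp in t2.
  pose proof (Rabs_pos (2 * PI * K)); pose proof (Rabs_pos (Re x)).
  rewrite <- (pow2_abs (2 * PI * K)), <- (pow2_abs (Re x)).
  set (a := Rabs (2 * PI * K)) in *; set (b := Rabs (Re x)) in *.
  apply Rle_trans with (a * b * (a * b))%R; [simpl; lra |].
  eapply Rle_trans; [apply Rmult_le_compat; [nra | nra | exact t1 | exact t2] |].
  simpl; lra. }
set (D := Cmod (x * x + _)) in *.
rewrite Cmod_mult, Cmod_R, Rabs_pos_eq by lra.
apply (Rmult_le_reg_r (D * (Re x ^ 2 * K ^ 2))).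
{ apply Rmult_lt_0_compat; [exact hd |]; apply Rmult_lt_0_compat; [exact hx2 |]; nra. }
replace (4 * Cmod x / D * (D * (Re x ^ 2 * K ^ 2)))%R with
  (Cmod x * (4 * K ^ 2 * Re x ^ 2))%R by (field; lra).
replace (Cmod x ^ 3 / Re x ^ 2 / K ^ 2 * (D * (Re x ^ 2 * K ^ 2)))%R with
  (Cmod x * (Cmod x ^ 2 * D))%R by (field; split; lra).
apply Rmult_le_compat_l; [lra |].
eapply Rle_trans; [| exact h].
replace ((2 * PI * K) ^ 2 * Re x ^ 2)%R with (PI * PI * (4 * K ^ 2 * Re x ^ 2))%R by ring.
assert (0 <= 4 * K ^ 2 * Re x ^ 2)%R as hA by (apply Rmult_le_pos; nra).
revert hA; generalize (4 * K ^ 2 * Re x ^ 2)%R; intros A hA.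
assert (1 <= PI * PI)%R by nra; nra.
Qed.

(** The polar parts [2 / x] are kept apart from the double sum over the square [d, k < N], as they
    carry no index [k]. *)
Definition coth_square (n : nat) (z : C) (N : nat) : C :=
  Csum (fun d => RtoC (/ INR (S d) ^ n)%R * (2 / coth_arg z d)) N +
  Csum (fun d => Csum (fun k => RtoC (/ INR (S d) ^ n)%R * Ccoth_term (coth_arg z d) k) N) N.

Lemma E_coth_square (n : nat) (z : C) : (3 <= n)%nat -> (0 < Im z)%R ->
  Clim (coth_square n z) (zeta_nat n * E (- INR n) z).
Proof.
intros hn hz.
assert (0 < 2 * PI)%R as hpi by (pose proof PI_RGT_0; lra).
assert (0 < Cmod z)%R as hz0.
{ apply Cmod_gt_0; intros e; rewrite e in hz; simpl in hz; lra. }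
pose proof (Clim_square_sum
  (fun d k => RtoC (/ INR (S d) ^ n)%R * Ccoth_term (coth_arg z d) k)
  (fun d => RtoC (/ INR (S d) ^ n)%R * (Ccoth (coth_arg z d) - 2 / coth_arg z d))
  (2 * PI * Cmod z ^ 3 / Im z ^ 2)) as h.
pose proof (pow_lt _ 3 hz0) as hz3.
pose proof (pow_lt _ 2 hz) as hz2.
lapply h; [clear h; intros h | apply Rdiv_le_0_compat; nra].
lapply h; [clear h; intros h |].
- lapply h; [clear h; intros h |].
  + pose proof (Clim_minus _ _ _ _ (E_coth_series n z ltac:(lia) hz) h) as h'.
    replace (zeta_nat n * E (- INR n) z) with (zeta_nat n * E (- INR n) z - 0) by ring.
    apply Clim_ext with (2 := h'); intros N; unfold coth_square.
    match goal with |- ?a - (?b - ?c) = ?d + ?c =>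
      replace b with (a - d); [ring | rewrite <- Csum_minus] end.
    apply Csum_ext; intros d _; ring.
  + intros d.
    apply Clim_ext with (fun N => RtoC (/ INR (S d) ^ n)%R * Csum (Ccoth_term (coth_arg z d)) N).
    * intros N; symmetry; apply Csum_scal.
    * apply Clim_mult; [apply Clim_const |].
      now apply Ccoth_partial_fractions, Re_coth_arg_neq_0.
- intros d k.
  rewrite Cmod_mult, Cmod_R, Rabs_pos_eq by (apply Rlt_le, inv_pow_pos).
  eapply Rle_trans;
    [apply Rmult_le_compat_l; [apply Rlt_le, inv_pow_pos |];
     now apply Ccoth_term_bound, Re_coth_arg_neq_0 |].
  rewrite Re_coth_arg.
  replace (Cmod (coth_arg z d)) with (2 * PI * INR (S d) * Cmod z)%R.
  2: { unfold coth_arg; rewrite Cmod_opp, !Cmod_mult, Cmod_Ci, Cmod_R, Rabs_pos_eq; [ring |].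
    apply Rmult_le_pos; [lra | apply pos_INR]. }
  assert (0 < INR (S d))%R as hD by (apply lt_0_INR; lia).
  unfold Rdiv; rewrite <- Rmult_assoc.
  apply Rmult_le_compat_r; [apply Rlt_le, inv_pow_pos |].
  (* Of the factor [d^(-n)], one power absorbs the linear growth of the bound, two give [1 / d^2],
     and the remaining [n - 3] are bounded by 1. *)
  replace n with (n - 3 + 3)%nat by lia; rewrite pow_add.
  pose proof (pow_lt (INR (S d)) (n - 3) hD).
  replace (/ (INR (S d) ^ (n - 3) * INR (S d) ^ 3) * ((2 * PI * INR (S d) * Cmod z) ^ 3 *
    / (2 * PI * INR (S d) * Im z) ^ 2))%R with
    (2 * PI * Cmod z ^ 3 * / Im z ^ 2 * / INR (S d) ^ 2 * / INR (S d) ^ (n - 3))%R.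
  + rewrite <- (Rmult_1_r (_ * / INR (S d) ^ 2)) at 2.
    apply Rmult_le_compat_l.
    * apply Rmult_le_pos; [| apply Rlt_le, inv_pow_pos].
      apply Rmult_le_pos; [nra | apply Rlt_le, Rinv_0_lt_compat, hz2].
    * rewrite <- Rinv_1; apply Rinv_le_contravar; [lra |].
      apply pow_R1_Rle, INR_S_ge_1.
  + field; repeat split; lra.
Qed.

(** * The reciprocity formula *)

Lemma Ci_sqr : Ci * Ci = - (1).
Proof. apply injective_projections; simpl; ring. Qed.

Lemma RtoC_PI_neq_0 : RtoC PI <> 0.
Proof. apply RtoC_neq_0, PI_neq0. Qed.

Lemma RtoC_INR_S_neq_0 (k : nat) : RtoC (INR (S k)) <> 0.
Proof. apply RtoC_neq_0, not_0_INR; lia. Qed.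

Lemma RtoC_inv_pow (k m : nat) : RtoC (/ INR (S k) ^ m)%R = / RtoC (INR (S k)) ^ m.
Proof.
rewrite RtoC_inv, RtoC_pow by (apply pow_nonzero, not_0_INR; lia); reflexivity.
Qed.

Lemma two_div_coth_arg (z : C) (d : nat) : z <> 0 ->
  2 / coth_arg z d = Ci / PI * (/ z * / INR (S d)).
Proof.
intros hz; pose proof RtoC_PI_neq_0; pose proof (RtoC_INR_S_neq_0 d); pose proof Ci_nz.
transitivity (2 * Ci / ((- (Ci * Ci)) * (2 * PI * INR (S d) * z))).
- unfold coth_arg; rewrite !RtoC_mult; field; repeat split; assumption.
- rewrite Ci_sqr; field; repeat split; assumption.
Qed.

Lemma Ccoth_term_coth_arg (z : C) (d k : nat) :
  RtoC (INR (S k)) ^ 2 - (INR (S d) * z) ^ 2 <> 0 ->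
  Ccoth_term (coth_arg z d) k =
  - (2 * Ci / PI) * (INR (S d) * z / (RtoC (INR (S k)) ^ 2 - (INR (S d) * z) ^ 2)).
Proof.
intros h; pose proof RtoC_PI_neq_0; unfold Ccoth_term.
replace (coth_arg z d * coth_arg z d + 4 * (PI * PI * (INR (S k) * INR (S k)))%R) with
  (4 * PI * PI * (RtoC (INR (S k)) ^ 2 - (INR (S d) * z) ^ 2)).
- unfold coth_arg; rewrite !RtoC_mult; field; split; assumption.
- unfold coth_arg; rewrite !RtoC_mult.
  transitivity ((Ci * Ci) * (2 * PI * INR (S d) * z) ^ 2 + 4 * (PI * PI * (INR (S k) * INR (S k))));
    [rewrite Ci_sqr; ring | ring].
Qed.

Lemma INR_sub_scaled_neq_0 (z : C) (d k : nat) : (Im z <> 0)%R ->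
  RtoC (INR (S k)) ^ 2 - (INR (S d) * z) ^ 2 <> 0.
Proof.
intros hz.
replace (RtoC (INR (S k)) ^ 2 - (INR (S d) * z) ^ 2) with
  ((RtoC (INR (S k)) + INR (S d) * z) * (RtoC (INR (S k)) - INR (S d) * z)) by ring.
assert (INR (S d) <> 0)%R as hd by (apply not_0_INR; lia).
assert (INR (S d) * Im z <> 0)%R as hdz by now apply Rmult_integral_contrapositive_currified.
revert hdz; generalize (INR (S d)) (INR (S k)); intros a b hab.
apply Cmult_neq_0; intros e; apply hab.
- transitivity (Im (b + a * z)); [destruct z; simpl; ring | rewrite e; reflexivity].
- transitivity (- Im (b - a * z))%R; [destruct z; simpl; ring | rewrite e; simpl; ring].
Qed.

Lemma Csum_geometric (X Y : C) (p : nat) :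
  (Y - X) * Csum (fun l => X ^ l * Y ^ (p - 1 - l)) p = Y ^ p - X ^ p.
Proof.
induction p as [|p IH]; [simpl; ring |].
rewrite Csum_S, Cmult_plus_distr_l.
rewrite (Csum_ext _ (fun l => Y * (X ^ l * Y ^ (p - 1 - l)))).
- rewrite Csum_scal.
  replace (S p - 1 - p)%nat with O by lia.
  transitivity (Y * ((Y - X) * Csum (fun l => X ^ l * Y ^ (p - 1 - l)) p) + (Y - X) * X ^ p).
  + simpl; ring.
  + rewrite IH, !Cpow_S; ring.
- intros l hl; replace (S p - 1 - l)%nat with (S (p - 1 - l)) by lia.
  rewrite Cpow_S; ring.
Qed.

(** With [w = - 1 / z] one has [b w / (a^2 - (b w)^2) = b z / (b^2 - (a z)^2)]: exchanging the
    indices makes the denominators agree. The sum over [l] is the geometric sum for [b^2] and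
    [(a z)^2], each term of which separates [a] from [b]. *)
Lemma reciprocity_term (c a b z : C) (p : nat) :
  a <> 0 -> b <> 0 -> z <> 0 -> b ^ 2 - (a * z) ^ 2 <> 0 ->
  / a ^ (2 * p + 1) * (c * (a * z / (b ^ 2 - (a * z) ^ 2))) -
  z ^ (2 * p) * (/ b ^ (2 * p + 1) * (c * (b * (- (1) / z) / (a ^ 2 - (b * (- (1) / z)) ^ 2)))) =
  c * Csum (fun l => z * (z ^ 2) ^ l * / a ^ (2 * (p - l)) * / b ^ (2 * S l)) p.
Proof.
intros ha hb hz h.
pose proof (Cpow_nz a (2 * p) ha) as hA; pose proof (Cpow_nz b (2 * p) hb) as hB.
rewrite (Csum_ext _ (fun l => z / (a ^ (2 * p) * b ^ (2 * p)) *
  (((a * z) ^ 2) ^ l * (b ^ 2) ^ (p - 1 - l)))).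
- rewrite Csum_scal.
  replace (Csum _ p) with ((b ^ (2 * p) - a ^ (2 * p) * z ^ (2 * p)) / (b ^ 2 - (a * z) ^ 2)).
  + rewrite !Cpow_add_r, !Cpow_1_r.
    field; repeat split; try assumption.
    intros e; apply h; rewrite <- Copp_0, <- e; ring.
  + apply (Cmult_cancel_l (b ^ 2 - (a * z) ^ 2) _ _ h).
    rewrite Csum_geometric, <- !Cpow_mult_r, (Cpow_mult_l a z (2 * p)); field; exact h.
- intros l hl.
  assert (a ^ (2 * p) = a ^ (2 * (p - l)) * a ^ (2 * l)) as e1
    by (rewrite <- Cpow_add_r; f_equal; lia).
  assert (b ^ (2 * p) = b ^ (2 * S l) * b ^ (2 * (p - 1 - l))) as e2
    by (rewrite <- Cpow_add_r; f_equal; lia).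
  rewrite e1, e2, Cpow_mult_l, Cpow_mult_l, <- !Cpow_mult_r.
  field; repeat split; apply Cpow_nz; assumption.
Qed.

Definition zeta_partial (m N : nat) : C := Csum (fun k => RtoC (/ INR (S k) ^ m)%R) N.

Lemma Im_opp_inv (z : C) : (0 < Im z)%R -> (0 < Im (- (1) / z))%R.
Proof.
intros hz; destruct z as [x y]; simpl in *.
replace (_ + _)%R with (y / (x * x + y * y))%R by (field; nra).
apply Rdiv_lt_0_compat; nra.
Qed.

(** The polar parts at [z] and [- 1 / z] give [/ z] and [z^(2p+1)], the sign of [- 1 / z] turning
    the difference into a sum; the double sums give products of truncated zeta values. *)
Lemma coth_square_reciprocity (p : nat) (z : C) (N : nat) : (0 < Im z)%R ->
  coth_square (2 * p + 1) z N - z ^ (2 * p) * coth_square (2 * p + 1) (- (1) / z) N =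
  Ci / PI * (/ z + z ^ (2 * p + 1)) * zeta_partial (2 * S p) N -
  2 * Ci / PI *
    Csum (fun l => z * (z ^ 2) ^ l * zeta_partial (2 * S l) N * zeta_partial (2 * (p - l)) N) p.
Proof.
intros him.
assert (z <> 0) as hz by (intros e; rewrite e in him; simpl in him; lra).
assert (- (1) / z <> 0) as hw.
{ apply Cmult_neq_0; [| intros e].
  - intros e; apply C1_nz; rewrite <- Copp_0, <- e; ring.
  - apply C1_nz; rewrite <- (Cinv_r z hz), e; ring. }
unfold coth_square.
(* Only the double sum at [- 1 / z] is transposed. *)
rewrite (Csum_exchange (fun d k => _ * Ccoth_term (coth_arg (- (1) / z) d) k)).
rewrite Cmult_plus_distr_l.
match goal with |- ?a + ?b - (?c + ?d) = _ =>
  transitivity ((a - c) + (b - d)); [ring |] end.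
unfold Cminus at 3; f_equal.
- unfold zeta_partial; rewrite <- !Csum_scal, <- Csum_minus.
  apply Csum_ext; intros d _.
  rewrite !two_div_coth_arg, !RtoC_inv_pow by assumption.
  replace (2 * S p)%nat with (2 * p + 1 + 1)%nat by lia.
  rewrite !Cpow_add_r, !Cpow_1_r.
  pose proof RtoC_PI_neq_0; pose proof (RtoC_INR_S_neq_0 d) as hd.
  pose proof (Cpow_nz _ (2 * p) hd).
  field; repeat split; try assumption.
- rewrite <- Csum_scal, <- Csum_minus.
  rewrite (Csum_ext _ (fun d => Csum (fun k => - (2 * Ci / PI) *
    Csum (fun l => z * (z ^ 2) ^ l * / RtoC (INR (S d)) ^ (2 * (p - l)) *
      / RtoC (INR (S k)) ^ (2 * S l)) p) N)).
  + rewrite (Csum_ext _ (fun d => - (2 * Ci / PI) * Csum (fun l =>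
      z * (z ^ 2) ^ l * zeta_partial (2 * S l) N * / RtoC (INR (S d)) ^ (2 * (p - l))) p)).
    * rewrite Csum_scal, Csum_exchange.
      match goal with |- - ?c * ?s = - (?c * ?t) => replace s with t; [ring |] end.
      apply Csum_ext; intros l _; rewrite Csum_scal; f_equal.
      apply Csum_ext; intros d _; apply RtoC_inv_pow.
    * intros d _; rewrite Csum_scal; f_equal; rewrite Csum_exchange.
      apply Csum_ext; intros l _; unfold zeta_partial; rewrite Csum_scal.
      rewrite (Csum_ext _ _ N (fun k _ => eq_sym (RtoC_inv_pow k (2 * S l)))); ring.
  + intros d _; rewrite <- Csum_scal, <- Csum_minus.
    apply Csum_ext; intros k _.
    pose proof (INR_sub_scaled_neq_0 z d k ltac:(lra)) as h1.
    assert (Im (- (1) / z) <> 0)%R as him' by (apply Rgt_not_eq; now apply Im_opp_inv).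
    pose proof (INR_sub_scaled_neq_0 (- (1) / z) k d him') as h2.
    rewrite !Ccoth_term_coth_arg, !RtoC_inv_pow by assumption.
    apply reciprocity_term; try assumption; apply RtoC_INR_S_neq_0.
Qed.

Lemma E_reciprocity (p : nat) (z : C) : (1 <= p)%nat -> (0 < Im z)%R ->
  zeta_nat (2 * p + 1) *
    (E (- INR (2 * p + 1)) z - z ^ (2 * p) * E (- INR (2 * p + 1)) (- (1) / z)) =
  Ci / PI * (/ z + z ^ (2 * p + 1)) * zeta_nat (2 * S p) -
  2 * Ci / PI *
    Csum (fun l => z * (z ^ 2) ^ l * zeta_nat (2 * S l) * zeta_nat (2 * (p - l))) p.
Proof.
intros hp hz.
apply Clim_unique with (fun N =>
  coth_square (2 * p + 1) z N - z ^ (2 * p) * coth_square (2 * p + 1) (- (1) / z) N).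
- replace (_ * _) with (zeta_nat (2 * p + 1) * E (- INR (2 * p + 1)) z -
    z ^ (2 * p) * (zeta_nat (2 * p + 1) * E (- INR (2 * p + 1)) (- (1) / z))) by ring.
  apply Clim_minus; [apply E_coth_square; [lia | exact hz] |].
  apply Clim_mult; [apply Clim_const |].
  apply E_coth_square; [lia | now apply Im_opp_inv].
- apply Clim_ext with (fun N =>
    Ci / PI * (/ z + z ^ (2 * p + 1)) * zeta_partial (2 * S p) N -
    2 * Ci / PI *
    Csum (fun l => z * (z ^ 2) ^ l * zeta_partial (2 * S l) N * zeta_partial (2 * (p - l)) N) p).
  { intros N; symmetry; now apply coth_square_reciprocity. }
  apply Clim_minus.
  + apply Clim_mult; [apply Clim_const | apply Clim_zeta_nat; lia].
  + apply Clim_mult; [apply Clim_const |].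
    assert (forall q, (q <= p)%nat -> Clim (fun N =>
      Csum (fun l => z * (z ^ 2) ^ l * zeta_partial (2 * S l) N * zeta_partial (2 * (p - l)) N) q)
      (Csum (fun l => z * (z ^ 2) ^ l * zeta_nat (2 * S l) * zeta_nat (2 * (p - l))) q)) as h;
      [| now apply h].
    induction q as [|q IH]; intros hq; [apply Clim_const |].
    apply Clim_plus; [apply IH; lia |].
    apply Clim_mult; [apply Clim_mult; [apply Clim_const |] |]; apply Clim_zeta_nat; lia.
Qed.

(** * From products of zeta values to products of Bernoulli numbers *)

Lemma bernoulli_coeff_zeta (j : nat) :
  (2 * PI * Ci) ^ (2 * S j) * bernoulli_coeff (2 * S j) = - 2 * zeta_nat (2 * S j).
Proof.
rewrite bernoulli_coeff_even, Cpow_mult_l.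
rewrite (Cpow_mult_r Ci); replace (Ci ^ 2) with (RtoC (-1)) by
  (apply injective_projections; simpl; ring).
rewrite <- !RtoC_mult, <- !RtoC_pow, <- !RtoC_mult; f_equal.
pose proof PI_RGT_0.
replace ((-1) ^ S j)%R with (- (-1) ^ j)%R by (simpl; ring).
transitivity (- 2 * ((-1) ^ j * (-1) ^ j) * zeta_nat (2 * S j))%R.
- field; apply pow_nonzero; lra.
- rewrite <- Rpow_mult_distr; replace (-1 * -1)%R with 1%R by ring; rewrite pow1; ring.
Qed.

(** The summand of the formula for [psi] divided by [(n + 1)!], where [n + 1 = 2 * S p]: the
    binomial coefficient is absorbed by the factorials. *)
Definition bernoulli_term (p : nat) (z : C) (m : nat) : C :=
  RtoC (bernoulli_coeff m) * bernoulli_coeff (2 * S p - m) * CpowerZ z (Z.of_nat m - 1).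

Lemma CpowerZ_pred (z : C) (m : nat) : CpowerZ z (Z.of_nat (S m) - 1) = z ^ m.
Proof.
unfold CpowerZ; replace (Z.of_nat (S m) - 1)%Z with (Z.of_nat m) by lia.
destruct (Z.leb_spec 0 (Z.of_nat m)); [| lia]; now rewrite Nat2Z.id.
Qed.

(** The two extreme terms, where one coefficient is [B_0 = 1], carry a single zeta value and match
    the polar parts; the inner even terms match the products. With [W = 2 pi i], one more factor [W]
    makes the exponent [2p + 2] split as the sum of the two Bernoulli indices. *)
Lemma bernoulli_sum (p : nat) (z : C) : (1 <= p)%nat -> z <> 0 ->
  (2 * PI * Ci) ^ (2 * p + 1) * Csum (bernoulli_term p z) (2 * S p + 1) =
  Ci / PI * (/ z + z ^ (2 * p + 1)) * zeta_nat (2 * S p) -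
  2 * Ci / PI *
    Csum (fun l => z * (z ^ 2) ^ l * zeta_nat (2 * S l) * zeta_nat (2 * (p - l))) p.
Proof.
intros hp hz.
pose proof RtoC_PI_neq_0 as hpi; pose proof Ci_nz as hci.
set (W := 2 * PI * Ci).
assert (W <> 0) as hW.
{ unfold W; repeat apply Cmult_neq_0; try assumption; apply RtoC_neq_0; lra. }
assert (Ci / PI = - 2 / W) as eW.
{ unfold W; transitivity (2 * (Ci * Ci) / (2 * PI * Ci)); [field; split; assumption |].
  rewrite Ci_sqr; field; split; assumption. }
apply (Cmult_cancel_l W _ _ hW).
rewrite Csum_even.
(* Odd terms vanish. At [m = 1] the coefficient is [- / 2], but its partner has the odd index
   [2p + 1 >= 3]. *)
2: { intros l hl; unfold bernoulli_term; destruct l as [|l].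
  - replace (2 * S p - (2 * 0 + 1))%nat with (2 * S (p - 1) + 1)%nat by lia.
    rewrite bernoulli_coeff_odd; ring.
  - rewrite bernoulli_coeff_odd; ring. }
rewrite (Nat.add_1_r (S p)), Csum_first, Csum_S.
unfold bernoulli_term.
replace (2 * S p - 2 * 0)%nat with (2 * S p)%nat by lia.
replace (2 * S p - 2 * S p)%nat with O by lia.
replace (CpowerZ z (Z.of_nat (2 * 0) - 1)) with (/ z)
  by (unfold CpowerZ; simpl; field; exact hz).
replace (CpowerZ z (Z.of_nat (2 * S p) - 1)) with (z ^ (2 * p + 1))
  by (rewrite <- CpowerZ_pred; do 2 f_equal; lia).
change (bernoulli_coeff (2 * 0)) with 1%R; change (bernoulli_coeff 0) with 1%R.
rewrite (Csum_ext (fun k => _ * CpowerZ z _) (fun l => 4 / W ^ (2 * S p) *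
  (z * (z ^ 2) ^ l * zeta_nat (2 * S l) * zeta_nat (2 * (p - l))))).
- rewrite Csum_scal.
  pose proof (bernoulli_coeff_zeta p) as e; fold W in e.
  assert (W ^ (2 * S p) <> 0) as hWp by now apply Cpow_nz.
  replace (RtoC (bernoulli_coeff (2 * S p))) with (- 2 * zeta_nat (2 * S p) / W ^ (2 * S p))
    by (rewrite <- e; field; exact hWp).
  replace (2 * Ci / PI) with (2 * (Ci / PI)) by (field; exact hpi).
  rewrite eW, Cmult_assoc, <- Cpow_S; replace (S (2 * p + 1)) with (2 * S p)%nat by lia.
  field; repeat split; assumption.
- intros l hl.
  replace (2 * S p - 2 * S l)%nat with (2 * S (p - 1 - l))%nat by lia.
  replace (CpowerZ z (Z.of_nat (2 * S l) - 1)) with (z ^ (2 * l + 1))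
    by (rewrite <- CpowerZ_pred; do 2 f_equal; lia).
  replace (p - l)%nat with (S (p - 1 - l)) by lia.
  pose proof (bernoulli_coeff_zeta l) as e1; fold W in e1.
  pose proof (bernoulli_coeff_zeta (p - 1 - l)) as e2; fold W in e2.
  replace (W ^ (2 * S p)) with (W ^ (2 * S l) * W ^ (2 * S (p - 1 - l)))
    by (rewrite <- Cpow_add_r; f_equal; lia).
  set (w1 := W ^ (2 * S l)) in *; set (w2 := W ^ (2 * S (p - 1 - l))) in *.
  assert (w1 <> 0) by now apply Cpow_nz.
  assert (w2 <> 0) by now apply Cpow_nz.
  replace (4 / (w1 * w2) * (z * (z ^ 2) ^ l * zeta_nat (2 * S l) * zeta_nat (2 * S (p - 1 - l))))
    with (/ (w1 * w2) * (- 2 * zeta_nat (2 * S l)) * (- 2 * zeta_nat (2 * S (p - 1 - l))) *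
      (z * (z ^ 2) ^ l)) by (field; split; assumption).
  rewrite <- e1, <- e2, Cpow_add_r, Cpow_1_r, Cpow_mult_r.
  field; split; assumption.
Qed.

(** * Analytic functions on the slit plane *)

Lemma pow_n_Cpow (x : C) (k : nat) : @pow_n C_Ring x k = x ^ k.
Proof. induction k as [|k IH]; [reflexivity | simpl; now rewrite IH]. Qed.

(** Convergence for the modulus of [C] is convergence of both components, which gives access to
    [Clim] for power series. *)
Lemma is_pseries_C (c : nat -> C) (x l : C) :
  @is_pseries C_AbsRing (AbsRing_NormedModule C_AbsRing) c x l <->
  Clim (Csum (fun k => c k * x ^ k)) l.
Proof.
assert (forall n, sum_n (G := AbsRing_NormedModule C_AbsRing)
  (fun k => scal (pow_n (x : C_AbsRing) k) (c k)) n = Csum (fun k => c k * x ^ k) (S n)) as e.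
{ intros n; rewrite <- Csum_sum_n; apply sum_n_ext; intros k.
  change (pow_n (K := C_Ring) x k * c k = c k * x ^ k); rewrite pow_n_Cpow; ring. }
unfold is_pseries, is_series; rewrite Clim_incr; split.
- intros h; split; apply is_lim_seq_spec; intros eps.
  + destruct (proj1 (filterlim_locally _ _) h eps) as [N hN]; exists N; intros n hn.
    specialize (hN n hn); rewrite e in hN.
    apply Rle_lt_trans with (2 := hN).
    exact (re_le_Cmod (Csum (fun k => c k * x ^ k) (S n) - l)).
  + destruct (proj1 (filterlim_locally _ _) h eps) as [N hN]; exists N; intros n hn.
    specialize (hN n hn); rewrite e in hN.
    apply Rle_lt_trans with (2 := hN).
    exact (Im_le_Cmod (Csum (fun k => c k * x ^ k) (S n) - l)).
- intros h; apply filterlim_locally; intros eps.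
  pose proof (Clim_Cmod _ _ (Clim_minus _ _ _ _ h (Clim_const l))) as h'.
  apply is_lim_seq_spec in h'; destruct (h' eps) as [N hN]; exists N; intros n hn.
  specialize (hN n hn); rewrite e.
  replace (l - l) with (RtoC 0) in hN by ring.
  rewrite Cmod_0, Rminus_0_r, Rabs_pos_eq in hN by apply Cmod_ge_0; exact hN.
Qed.

Lemma analytic_at_iff (f : C -> C) (z0 : C) :
  analytic_at f z0 <-> exists (c : nat -> C) (r : R), (0 < r)%R /\
    forall z, (Cmod (z - z0) < r)%R -> Clim (Csum (fun k => c k * (z - z0) ^ k)) (f z).
Proof.
split; intros (c & r & hr & h); exists c, r; split; try exact hr; intros z hz;
  apply is_pseries_C, h, hz.
Qed.

Lemma analytic_at_plus (f g : C -> C) (z0 : C) :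
  analytic_at f z0 -> analytic_at g z0 -> analytic_at (fun z => f z + g z) z0.
Proof.
rewrite !analytic_at_iff; intros (a & r & hr & ha) (b & s & hs & hb).
exists (fun k => a k + b k), (Rmin r s); split; [now apply Rmin_pos |].
intros z hz; pose proof (Rmin_l r s); pose proof (Rmin_r r s).
apply Clim_ext with (fun n => Csum (fun k => a k * (z - z0) ^ k) n +
  Csum (fun k => b k * (z - z0) ^ k) n).
- intros n; rewrite <- Csum_plus; apply Csum_ext; intros k _; ring.
- apply Clim_plus; [apply ha | apply hb]; lra.
Qed.

Lemma analytic_at_scal (c : C) (f : C -> C) (z0 : C) :
  analytic_at f z0 -> analytic_at (fun z => c * f z) z0.
Proof.
rewrite !analytic_at_iff; intros (a & r & hr & ha).
exists (fun k => c * a k), r; split; [exact hr |]; intros z hz.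
apply Clim_ext with (fun n => c * Csum (fun k => a k * (z - z0) ^ k) n).
- intros n; rewrite <- Csum_scal; apply Csum_ext; intros k _; ring.
- apply Clim_mult; [apply Clim_const | now apply ha].
Qed.

Lemma analytic_at_const (c z0 : C) : analytic_at (fun _ => c) z0.
Proof.
apply analytic_at_iff; exists (fun k => match k with O => c | S _ => 0 end), 1%R.
split; [lra |]; intros z _; apply Clim_incr.
apply Clim_ext with (2 := Clim_const c); intros n.
rewrite Csum_first, Csum_zero; [simpl; ring | intros; ring].
Qed.

(** Write [z = z0 + (z - z0)]; the second factor shifts the coefficients by one. *)
Lemma analytic_at_mult_id (f : C -> C) (z0 : C) :
  analytic_at f z0 -> analytic_at (fun z => z * f z) z0.
Proof.
rewrite !analytic_at_iff; intros (a & r & hr & ha).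
exists (fun k => z0 * a k + match k with O => 0 | S j => a j end), r.
split; [exact hr |]; intros z hz; apply Clim_incr.
replace (z * f z) with (z0 * f z + (z - z0) * f z) by ring.
apply Clim_ext with (fun n => z0 * Csum (fun k => a k * (z - z0) ^ k) (S n) +
  (z - z0) * Csum (fun k => a k * (z - z0) ^ k) n).
- intros n; rewrite <- !Csum_scal; symmetry.
  rewrite (Csum_ext _ (fun k => z0 * (a k * (z - z0) ^ k) +
    match k with O => 0 | S j => a j end * (z - z0) ^ k) (S n)) by (intros; ring).
  rewrite Csum_plus; f_equal.
  rewrite Csum_first, Cmult_0_l, Cplus_0_l; apply Csum_ext; intros k _.
  rewrite Cpow_S; ring.
- apply Clim_plus; apply Clim_mult; try apply Clim_const.
  + apply (proj1 (Clim_incr _ _)); now apply ha.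
  + now apply ha.
Qed.

(** Geometric series in [y = - (z - z0) / z0], from [1 - y = z / z0]. *)
Lemma analytic_at_inv (z0 : C) : z0 <> 0 -> analytic_at Cinv z0.
Proof.
intros h0; apply analytic_at_iff.
exists (fun k => / z0 * (- / z0) ^ k), (Cmod z0).
pose proof (proj1 (Cmod_gt_0 z0) h0) as hm; split; [exact hm |].
intros z hz; set (y := - / z0 * (z - z0)).
assert (Cmod y < 1)%R as hy.
{ unfold y; rewrite Cmod_mult, Cmod_opp, Cmod_inv by exact h0.
  apply Rmult_lt_reg_l with (Cmod z0); [exact hm |].
  replace (Cmod z0 * (/ Cmod z0 * Cmod (z - z0)))%R with (Cmod (z - z0)) by (field; lra).
  lra. }
assert (z <> 0) as hz0.
{ intros e; rewrite e in hz; replace (0 - z0) with (- z0) in hz by ring.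
  rewrite Cmod_opp in hz; lra. }
assert (1 - y = z / z0) as e1 by (unfold y; field; exact h0).
assert (1 - y <> 0) as hy1 by (rewrite e1; apply Cmult_neq_0;
  [exact hz0 |]; intros e; apply C1_nz; rewrite <- (Cinv_r z0 h0), e; ring).
replace (/ z) with (/ z0 * ((1 - 0) / (1 - y)))
  by (rewrite e1; field; split; assumption).
apply Clim_ext with (fun n => / z0 * ((1 - y ^ n) / (1 - y))).
- intros n.
  rewrite (Csum_ext _ (fun k => / z0 * (y ^ k * 1 ^ (n - 1 - k)))).
  + rewrite Csum_scal; f_equal; apply (Cmult_cancel_l (1 - y) _ _ hy1).
    rewrite Csum_geometric, Cpow_1_l; field; exact hy1.
  + intros k _; unfold y; rewrite Cpow_1_l, Cpow_mult_l; ring.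
- apply Clim_mult; [apply Clim_const |].
  apply Clim_div; [exact hy1 | | apply Clim_const].
  apply Clim_minus; [apply Clim_const |].
  apply Clim_0_bound with (e := fun n => (Cmod y ^ n)%R) (N := O).
  + intros n _; rewrite Cmod_pow; lra.
  + apply is_lim_seq_geom; rewrite Rabs_pos_eq; [exact hy | apply Cmod_ge_0].
Qed.

Lemma analytic_at_Csum (f : nat -> C -> C) (N : nat) (z0 : C) :
  (forall m, analytic_at (f m) z0) -> analytic_at (fun z => Csum (fun m => f m z) N) z0.
Proof.
intros h; induction N as [|N IH]; simpl; [apply analytic_at_const |].
now apply (analytic_at_plus (fun z => Csum (fun m => f m z) N)).
Qed.

Lemma analytic_at_pow (m : nat) (z0 : C) : analytic_at (fun z => z ^ m) z0.
Proof.
induction m as [|m IH]; [exact (analytic_at_const 1 z0) |].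
now apply (analytic_at_mult_id (fun z => z ^ m)).
Qed.

Lemma analytic_at_CpowerZ (m : nat) (z0 : C) :
  z0 <> 0 -> analytic_at (fun z => CpowerZ z (Z.of_nat m - 1)) z0.
Proof.
intros h0; destruct m as [|m].
- destruct (analytic_at_inv z0 h0) as (c & r & hr & h); exists c, r; split; [exact hr |].
  intros z hz; unfold CpowerZ; simpl; rewrite Cmult_1_r; now apply h.
- destruct (analytic_at_pow m z0) as (c & r & hr & h); exists c, r; split; [exact hr |].
  intros z hz; rewrite CpowerZ_pred; now apply h.
Qed.

(** * Identity theorem along segments *)

(** Let [t0] be the supremum of the [t] with [phi = 0] on [[0, t]]. Vanishing on the left of [t0]
    kills the expansion at [t0], so [phi] vanishes on both sides of it, which forces [t0 = 1] and
    covers the endpoint. *)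
Lemma real_analytic_zero (phi : R -> R) (d : R) :
  (forall t0, (0 <= t0 <= 1)%R -> exists (a : nat -> R) (r : R), (0 < r)%R /\
    forall t, (Rabs (t - t0) < r)%R -> is_pseries a (t - t0)%R (phi t)) ->
  (0 < d)%R -> (forall t, (0 <= t < d)%R -> phi t = 0%R) -> phi 1%R = 0%R.
Proof.
intros ha hd hz.
set (P := fun t => (0 <= t <= 1)%R /\ forall s, (0 <= s <= t)%R -> phi s = 0%R).
destruct (completeness P) as [t0 [hub hlub]].
- exists 1%R; intros t [ht _]; lra.
- exists 0%R; split; [lra |]; intros s hs; apply hz; lra.
- assert (t0 <= 1)%R as h1 by (apply hlub; intros t [ht _]; lra).
  assert (0 < t0)%R as h0.
  { apply Rlt_le_trans with (Rmin 1 (d / 2)); [apply Rmin_pos; lra |].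
    pose proof (Rmin_l 1 (d / 2)); pose proof (Rmin_r 1 (d / 2)).
    assert (0 < Rmin 1 (d / 2))%R by (apply Rmin_pos; lra).
    apply hub; split; [lra |]; intros s hs; apply hz; lra. }
  assert (forall s, (0 <= s < t0)%R -> phi s = 0%R) as hleft.
  { intros s hs; destruct (classic (phi s = 0%R)) as [h|h]; [exact h | exfalso].
    assert (t0 <= s)%R; [| lra].
    apply hlub; intros t [ht ht']; destruct (Rle_dec t s) as [hl|hl]; [exact hl |].
    exfalso; apply h, ht'; lra. }
  destruct (ha t0 ltac:(lra)) as (a & r & hr & h).
  assert (forall k, a k = 0%R) as hak.
  { apply pseries_left_zero with (Rmin r t0); [now apply Rmin_pos |].
    intros t ht; pose proof (Rmin_l r t0); pose proof (Rmin_r r t0).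
    rewrite <- (hleft (t0 + t)%R) by lra.
    replace t with (t0 + t - t0)%R at 1 by ring; apply h.
    replace (t0 + t - t0)%R with t by ring; rewrite Rabs_left; lra. }
  assert (forall t, (Rabs (t - t0) < r)%R -> phi t = 0%R) as hloc.
  { intros t ht; rewrite <- (is_pseries_unique _ _ _ (h t ht)).
    apply is_pseries_unique, is_pseries_R.
    apply (is_lim_seq_ext (fun _ => 0%R) _ 0%R); [| apply is_lim_seq_const].
    intros n; rewrite (sum_n_ext _ (fun _ => 0%R)) by (intros k; rewrite hak; apply Rmult_0_l).
    rewrite sum_n_const; ring. }
  assert (P (Rmin 1 (t0 + r / 2))) as hP.
  { pose proof (Rmin_l 1 (t0 + r / 2)); pose proof (Rmin_r 1 (t0 + r / 2)).
    split.
    - split; [| lra]; apply Rmin_glb; lra.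
    - intros s hs; destruct (Rlt_dec s t0) as [hl|hl]; [apply hleft; lra |].
      apply hloc; rewrite Rabs_pos_eq; lra. }
  destruct (Rlt_dec t0 1) as [hl|hl].
  + exfalso; specialize (hub _ hP); revert hub; apply Rlt_not_le, Rmin_glb_lt; lra.
  + apply hloc; replace (1 - t0)%R with 0%R by lra; now rewrite Rabs_R0.
Qed.

(** Along a line the powers are [(t - t0)^k v^k] with [t - t0] real, so taking real parts gives a
    real power series. The [+ 1] in the radius allows [v = 0]. *)
Lemma analytic_at_segment (f : C -> C) (w v : C) (t0 : R) :
  analytic_at f (w + t0 * v) -> exists (a : nat -> R) (r : R), (0 < r)%R /\
    forall t, (Rabs (t - t0) < r)%R -> is_pseries a (t - t0)%R (Re (f (w + t * v))).
Proof.
rewrite analytic_at_iff; intros (c & r & hr & h).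
exists (fun k => Re (c k * v ^ k)), (r / (Cmod v + 1))%R.
pose proof (Cmod_ge_0 v); split; [apply Rdiv_lt_0_compat; lra |].
intros t ht; apply is_pseries_R.
assert (w + t * v - (w + t0 * v) = (t - t0)%R * v) as e by (rewrite RtoC_minus; ring).
destruct (proj1 (Clim_incr _ _) (h (w + t * v) ltac:(
  rewrite e, Cmod_mult, Cmod_R;
  apply (Rmult_lt_compat_r (Cmod v + 1)) in ht; [| lra];
  replace (r / (Cmod v + 1) * (Cmod v + 1))%R with r in ht by (field; lra);
  pose proof (Rabs_pos (t - t0)); nra))) as [h1 _].
revert h1; apply is_lim_seq_ext; intros n; rewrite Re_Csum.
apply sum_n_ext; intros k.
rewrite e, Cpow_mult_l, <- RtoC_pow.
rewrite <- re_scal_r; f_equal; ring.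
Qed.

Lemma analytic_Re_eq_segment (f g : C -> C) (w z : C) :
  analytic_on slit_plane f -> analytic_on slit_plane g ->
  (forall u, upper_half_plane u -> Re (f u) = Re (g u)) ->
  upper_half_plane w ->
  (forall t : R, (0 <= t <= 1)%R -> slit_plane (w + t * (z - w))) ->
  Re (f z) = Re (g z).
Proof.
intros hf hg hfg hw hs.
assert (Re (f (w + 1 * (z - w))%C) - Re (g (w + 1 * (z - w))%C) = 0)%R as h.
(* Below this value of [t] the segment has not yet left the upper half-plane; the [+ 1] covers a
   horizontal segment. *)
{ apply (real_analytic_zero (fun t : R => Re (f (w + t * (z - w))%C) - Re (g (w + t * (z - w))%C))%R
    (Im w / (Rabs (Im (z - w)) + 1))%R).
  - intros t0 ht0.
    destruct (analytic_at_segment f w (z - w) t0 (hf _ (hs t0 ht0))) as (a & r & hr & ha).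
    destruct (analytic_at_segment g w (z - w) t0 (hg _ (hs t0 ht0))) as (b & s & hs' & hb).
    exists (fun k => a k - b k)%R, (Rmin r s); split; [now apply Rmin_pos |].
    intros t ht; pose proof (Rmin_l r s); pose proof (Rmin_r r s).
    apply (is_pseries_minus a b); [apply ha | apply hb]; lra.
  - pose proof (Rabs_pos (Im (z - w))); apply Rdiv_lt_0_compat; [exact hw | lra].
  - intros t ht; rewrite hfg; [ring |].
    unfold upper_half_plane in *.
    replace (Im (w + t * (z - w))) with (Im w + t * Im (z - w))%R
      by (destruct w; destruct z; simpl; ring).
    pose proof (Rabs_pos (Im (z - w))).
    destruct ht as [ht0 ht]; apply (Rmult_lt_compat_r (Rabs (Im (z - w)) + 1)) in ht; [| lra].
    replace (Im w / (Rabs (Im (z - w)) + 1) * (Rabs (Im (z - w)) + 1))%R with (Im w) in ht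
      by (field; lra).
    pose proof (Rle_abs (- Im (z - w))) as hr; rewrite Rabs_Ropp in hr; nra. }
replace (w + 1 * (z - w)) with z in h by ring; lra.
Qed.

Lemma analytic_Re_eq (f g : C -> C) :
  analytic_on slit_plane f -> analytic_on slit_plane g ->
  (forall u, upper_half_plane u -> Re (f u) = Re (g u)) ->
  forall z, slit_plane z -> Re (f z) = Re (g z).
Proof.
intros hf hg hfg z hz.
destruct (Rtotal_order (Im z) 0) as [h|[h|h]].
- (* The segment from [2 - z] to [z] crosses the real axis at its midpoint [1]. *)
  apply analytic_Re_eq_segment with (2 - z); try assumption.
  + unfold upper_half_plane; destruct z; simpl in *; lra.
  + intros t ht [e1 e2]; destruct z as [x y]; simpl in *.
    assert (t = / 2)%R by nra; subst t; lra.
(* For [z] on the positive axis, the vertical segment from [z + Ci] meets the real line only at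
   [z]. *)
- apply analytic_Re_eq_segment with (z + Ci); try assumption.
  + unfold upper_half_plane; destruct z; simpl in *; lra.
  + intros t ht [e1 e2]; apply hz; destruct z as [x y]; simpl in *; split; lra.
- now apply hfg.
Qed.

Lemma analytic_eq (f g : C -> C) :
  analytic_on slit_plane f -> analytic_on slit_plane g ->
  (forall u, upper_half_plane u -> f u = g u) ->
  forall z, slit_plane z -> f z = g z.
Proof.
intros hf hg hfg z hz; apply injective_projections.
- apply (analytic_Re_eq f g); try assumption; intros u hu; now rewrite hfg.
(* The imaginary part of [f] is the real part of [- Ci * f], which is again analytic. *)
- assert (Re (- Ci * f z) = Re (- Ci * g z)) as h.
  { apply (analytic_Re_eq (fun z => - Ci * f z) (fun z => - Ci * g z)); try assumption.
    - intros u hu; now apply analytic_at_scal, hf.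
    - intros u hu; now apply analytic_at_scal, hg.
    - intros u hu; now rewrite hfg. }
  simpl in h; lra.
Qed.

(** * The period function and the closed formulas *)

Lemma Cexp_Clog (z : C) : upper_half_plane z -> Cexp (Clog z) = z.
Proof.
intros hz; unfold upper_half_plane in hz.
assert (0 < Cmod z)%R as hm by (apply Cmod_gt_0; intros e; rewrite e in hz; simpl in hz; lra).
unfold Cexp, Clog, Carg; simpl Re; simpl Im.
destruct (Rle_dec 0 (Im z)) as [_|h]; [| lra].
rewrite exp_ln by exact hm.
assert (Rabs (Re z) <= Cmod z)%R as hb by apply re_le_Cmod.
apply Rabs_le_between in hb.
assert (-1 <= Re z / Cmod z <= 1)%R as hb'.
{ split; apply (Rmult_le_reg_r (Cmod z)); try exact hm;
    replace (Re z / Cmod z * Cmod z)%R with (Re z) by (field; lra); lra. }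
rewrite cos_acos, sin_acos by exact hb'.
assert (Cmod z * Cmod z = Re z * Re z + Im z * Im z)%R as e.
{ unfold Cmod; rewrite sqrt_sqrt; [unfold Re, Im; ring | nra]. }
replace (1 - Rsqr (Re z / Cmod z))%R with (Rsqr (Im z / Cmod z)).
- rewrite sqrt_Rsqr by (apply Rdiv_le_0_compat; lra).
  destruct z as [x y]; simpl Re in *; simpl Im in *.
  apply injective_projections; simpl fst; simpl snd; field; lra.
- unfold Rsqr; apply (Rmult_eq_reg_r (Cmod z * Cmod z)); [| nra].
  transitivity (Im z * Im z)%R; [field; lra |].
  transitivity (Cmod z * Cmod z - Re z * Re z)%R; [lra | field; lra].
Qed.

Lemma Cpower_INR (z : C) (m : nat) : upper_half_plane z -> Cpower z (INR m) = z ^ m.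
Proof. intros hz; unfold Cpower; now rewrite Cexp_INR_mult, Cexp_Clog. Qed.

Lemma slit_plane_neq_0 (z : C) : slit_plane z -> z <> 0.
Proof. intros h e; apply h; rewrite e; simpl; lra. Qed.

(** The right-hand side is a Laurent polynomial in [z], hence analytic off 0, and by the reciprocity
    formula it satisfies [is_psi]. So [epsilon] returns some function with this property, and two
    such functions agree on the slit plane. *)
Lemma psi_bernoulli_sum (p : nat) (z : C) : (1 <= p)%nat -> slit_plane z ->
  psi (- INR (2 * p + 1)) z =
  / zeta_nat (2 * p + 1) * ((2 * PI * Ci) ^ (2 * p + 1) *
    Csum (bernoulli_term p z) (2 * S p + 1)).
Proof.
intros hp.
set (F := fun z => / zeta_nat (2 * p + 1) * ((2 * PI * Ci) ^ (2 * p + 1) *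
    Csum (bernoulli_term p z) (2 * S p + 1))).
assert (is_psi (- INR (2 * p + 1)) F) as hF.
{ split.
  - intros u hu; unfold F.
    apply analytic_at_scal, analytic_at_scal.
    apply (analytic_at_Csum (fun m z => bernoulli_term p z m)); intros m; unfold bernoulli_term.
    now apply analytic_at_scal, analytic_at_CpowerZ, slit_plane_neq_0.
  - intros u hu; unfold F.
    assert (u <> 0) as hu0.
    { apply slit_plane_neq_0; intros [e _]; unfold upper_half_plane in hu; lra. }
    rewrite bernoulli_sum, <- E_reciprocity by assumption.
    (* For [a = - n] the exponent [- a - 1] is the natural number [2p], so the principal branch is
       an ordinary power. *)
    replace (- - INR (2 * p + 1) - 1) with (RtoC (INR (2 * p))).
    + rewrite Cpower_INR by exact hu.
      replace (- 1 / u) with (- (1) / u) by (unfold Cdiv; ring).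
      field; apply RtoC_neq_0; pose proof (zeta_nat_ge_1 (2 * p + 1) ltac:(lia)); lra.
    + rewrite plus_INR, RtoC_plus; simpl (INR 1); ring. }
assert (is_psi (- INR (2 * p + 1)) (psi (- INR (2 * p + 1)))) as hpsi
  by (unfold psi; apply epsilon_spec; now exists F).
apply (analytic_eq _ F); [apply hpsi | apply hF |].
intros u hu; rewrite (proj2 hpsi), (proj2 hF) by exact hu; reflexivity.
Qed.

Lemma binomial_bernoulli (N m : nat) : (m <= N)%nat ->
  Binomial.C N m * bernoulli m * bernoulli (N - m) =
  RtoC (INR (fact N)) * (RtoC (bernoulli_coeff m) * bernoulli_coeff (N - m)).
Proof.
intros hm; rewrite !bernoulli_value, <- !RtoC_mult; f_equal.
unfold Binomial.C; field; split; apply INR_fact_neq_0.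
Qed.

(** The cosine vanishes at odd multiples of [PI / 2]; this removes the cotangent term from the
    definition of [g]. *)
Lemma Ccot_odd (p : nat) : Ccot (PI * (- INR (2 * p + 1)) / 2) = 0.
Proof.
unfold Ccot.
replace (PI * (- INR (2 * p + 1)) / 2) with (RtoC (- (PI / 2 + INR p * PI))%R).
- replace (Ccos _) with (RtoC 0); [unfold Cdiv; ring |].
  unfold Ccos.
  replace (- (Ci * RtoC (- (PI / 2 + INR p * PI))%R)) with (Ci * RtoC (PI / 2 + INR p * PI)%R)
    by (rewrite RtoC_opp; ring).
  rewrite !Cexp_Ci, cos_neg, sin_neg.
  assert (cos (PI / 2 + INR p * PI) = 0)%R as e.
  { apply cos_eq_0_1; exists (Z.of_nat p); rewrite <- INR_IZR_INZ; ring. }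
  rewrite e; apply injective_projections; simpl; field.
- rewrite plus_INR, mult_INR; simpl (INR 1); simpl (INR 2).
  rewrite RtoC_opp, !RtoC_plus, !RtoC_mult, RtoC_div, !RtoC_plus by lra; field.
Qed.

Theorem theorem4 (n : nat) (hn : (1 < n)%nat) (hodd : Nat.Odd n)
    (z : C) (hz : slit_plane z) :
  psi (- INR n)%C z =
    (2 * PI * Ci) ^ n / (zeta (INR n) * INR (fact (n + 1))) *
    sum_n (fun m : nat =>
      Binomial.C (n + 1) m * bernoulli m * bernoulli (n + 1 - m)
        * CpowerZ z (Z.of_nat m - 1)) (n + 1)
  /\
  g (- INR n)%C z =
    (2 * PI * Ci) ^ n / (Ci * INR (fact (n + 1))) *
    sum_n (fun m : nat =>
      Binomial.C (n + 1) (m + 1) * bernoulli (m + 1) * bernoulli (n - m)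
        * z ^ m) n.
Proof.
destruct hodd as [p hp]; subst n.
assert (1 <= p)%nat as hp1 by lia.
pose proof (slit_plane_neq_0 z hz) as hz0.
pose proof RtoC_PI_neq_0 as hpi; pose proof Ci_nz as hci.
assert (RtoC (zeta_nat (2 * p + 1)) <> 0) as hzeta
  by (apply RtoC_neq_0; pose proof (zeta_nat_ge_1 (2 * p + 1) ltac:(lia)); lra).
assert (RtoC (INR (fact (2 * p + 1 + 1))) <> 0) as hfact
  by (apply RtoC_neq_0, INR_fact_neq_0).
pose proof (psi_bernoulli_sum p z hp1 hz) as hpsi.
split.
- rewrite hpsi, zeta_INR by lia; rewrite Csum_sum_n; symmetry.
  rewrite (Csum_ext _ (fun m => INR (fact (2 * p + 1 + 1)) * bernoulli_term p z m)).
  + rewrite Csum_scal; replace (S (2 * p + 1 + 1)) with (2 * S p + 1)%nat by lia.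
    field; split; assumption.
  + intros m hm; rewrite binomial_bernoulli by lia; unfold bernoulli_term.
    replace (2 * p + 1 + 1 - m)%nat with (2 * S p - m)%nat by lia; ring.
(* What is subtracted from [psi] is now only its polar part, which is the term [m = 0] of the
   Bernoulli sum; dropping it shifts the index by one. *)
- unfold g; rewrite Ccot_odd, Cmult_0_r, hpsi.
  replace (- - INR (2 * p + 1)) with (RtoC (INR (2 * p + 1))) by ring.
  replace (1 - - INR (2 * p + 1)) with (RtoC (INR (2 * S p))).
  2: { replace (2 * S p)%nat with (2 * p + 1 + 1)%nat by lia.
    rewrite (plus_INR (2 * p + 1)), RtoC_plus; simpl (INR 1); ring. }
  rewrite !zeta_INR by lia; rewrite Csum_sum_n; symmetry.
  rewrite (Csum_ext _ (fun m => INR (fact (2 * p + 1 + 1)) * bernoulli_term p z (S m))).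
  + rewrite Csum_scal; replace (2 * S p + 1)%nat with (S (S (2 * p + 1))) by lia.
    rewrite (Csum_first (bernoulli_term p z)).
    (* Euler's formula concerns the even power [2p + 2]; the missing factor [2 pi i] is supplied
       before cancelling. *)
    assert ((2 * PI * Ci) ^ (2 * p + 1) * bernoulli_term p z 0 =
      Ci / (PI * z) * zeta_nat (2 * S p)) as e.
    { pose proof (bernoulli_coeff_zeta p) as e.
      replace (2 * S p)%nat with (S (2 * p + 1)) in e at 1 by lia; rewrite Cpow_S in e.
      unfold bernoulli_term; rewrite Nat.sub_0_r.
      change (bernoulli_coeff 0) with 1%R.
      replace (CpowerZ z (Z.of_nat 0 - 1)) with (/ z)
        by (unfold CpowerZ; simpl; field; exact hz0).
      apply (Cmult_cancel_l (2 * PI * Ci)).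
      - repeat apply Cmult_neq_0; try assumption; apply RtoC_neq_0; lra.
      - transitivity (2 * PI * Ci * (2 * PI * Ci) ^ (2 * p + 1) * bernoulli_coeff (2 * S p) * / z);
          [ring |].
        rewrite e; transitivity (2 * (Ci * Ci) * zeta_nat (2 * S p) / z);
          [rewrite Ci_sqr; field; assumption | field; split; assumption]. }
    rewrite (Cmult_plus_distr_l _ (bernoulli_term p z 0)), e.
    field; repeat split; try assumption.
  + intros m hm.
    replace (2 * p + 1 - m)%nat with (2 * p + 1 + 1 - (m + 1))%nat by lia.
    rewrite binomial_bernoulli by lia; unfold bernoulli_term; rewrite CpowerZ_pred.
    replace (m + 1)%nat with (S m) by lia.
    replace (2 * p + 1 + 1 - S m)%nat with (2 * S p - S m)%nat by lia; ring.
Qed.
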